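(* Let $(K,v)$ be a henselian valued field of arbitrary rank, let $w$ be an extension of $v$ to $K(X)$, and let $Q$ be an abstract key polynomial (ABKP) for $w$ such that $w_Q<w$. Then for an ABKP $F\in K[X]$ for $w$ the following are equivalent: (i) $(F,Q)$ is a distinguished pair. (ii) $F\in\psi(Q)$ and $\deg F>\deg Q$.
   Context: Let $\bar v$ be the extension of $v$ to a fixed algebraic closure $\overline K$ of $K$. For $\theta\in\overline K$, $\deg\theta=[K(\theta):K]$. For $f\in K[X]$ and a positive integer $b$, $\partial_b f=\frac{1}{b!}\frac{\partial^b f}{\partial X^b}$ is the $b$-th formal (Hasse) derivative, and $\epsilon(f)=\max_{b\in\mathbb N}\frac{w(f)-w(\partial_b f)}{b}$, where $\mathbb N$ is the set of positive integers (an element of the divisible hull of the value group $\Gamma_w$; terms with $\partial_b f=0$ count as $-\infty$). A monic nonconstant polynomial $Q\in K[X]$ is an abstract key polynomial (ABKP) for $w$ if every $f\in K[X]$ with $\epsilon(f)\ge\epsilon(Q)$ satisfies $\deg f\ge\deg Q$. ABKPs are irreducible over $K$. The $Q$-truncation of $w$ is $w_Q(f)=\min_i\{w(f_iQ^i)\}$, where $f=\sum_i f_iQ^i$, $\deg f_i<\deg Q$, is the $Q$-expansion of $f$; for an ABKP $Q$ it is a valuation on $K(X)$, and $w_Q\le w$ on $K[X]$. Write $w_Q<w$ if $w_Q\ne w$. Put $\alpha(Q)=\min\{\deg f\mid w_Q(f)<w(f)\}$ ($=\infty$ if $w_Q=w$) and $\psi(Q)=\{f\in K[X]\mid f\text{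 monic},\ w_Q(f)<w(f),\ \deg f=\alpha(Q)\}$. A pair $(\theta,\alpha)$ of elements of $\overline K$ is a $(K,v)$-distinguished pair if: $\deg\theta>\deg\alpha$; $\bar v(\theta-\alpha)=\max\{\bar v(\theta-\beta)\mid\beta\in\overline K,\ \deg\beta<\deg\theta\}$; and $\bar v(\theta-\eta)<\bar v(\theta-\alpha)$ for every $\eta\in\overline K$ with $\deg\eta<\deg\alpha$. For irreducible polynomials $g,f$ over $K$, $(g,f)$ is a distinguished pair if there are a root $\theta$ of $g$ and a root $\alpha$ of $f$ such that $(\theta,\alpha)$ is a $(K,v)$-distinguished pair. *)

(* Defs.v *)
From HB Require Import structures.
From mathcomp Require Import all_boot all_order all_algebra.
From mathcomp Require Import mathcomp_extra boolp classical_sets.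

Set Implicit Arguments.
Unset Strict Implicit.
Unset Printing Implicit Defensive.

Import Order.TTheory GRing.Theory.

Local Open Scope classical_set_scope.
Local Open Scope ring_scope.

(* A divisible totally ordered abelian group is the same thing as a totally
   ordered rational vector space.  Valuations below take values in such a group
   and are not assumed surjective: an arbitrary value group is covered by
   embedding it in its divisible hull, which is also where the values of
   [epsilon] and of the extension to the algebraic closure live. *)
HB.mixin Record isOrderedAddGroup G of Num.POrderedZmodule G := {
  oag_le_total : total (<=%R : rel G);
  oag_leD2r : forall z x y : G, x <= y -> x + z <= y + z
}.

#[short(type="divOagType")]
HB.structure Definition DivOAG :=
  { G of Num.POrderedZmodule G & GRing.Lmodule rat G & isOrderedAddGroup G }.

(* PInf is the value of 0; NInf only occurs as a value of [epsilon]. *)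
Inductive ext (G : Type) := NInf | Fin of G | PInf.
Arguments NInf {G}.
Arguments PInf {G}.

Section ExtOrder.
Variable G : divOagType.
Implicit Types a b : ext G.

Definition ext_code a : option (option G) :=
  match a with NInf => None | Fin x => Some (Some x) | PInf => Some None end.

Definition ext_decode (o : option (option G)) : ext G :=
  match o with None => NInf | Some (Some x) => Fin x | Some None => PInf end.

Lemma ext_codeK : cancel ext_code ext_decode.
Proof. by case. Qed.

HB.instance Definition _ := Choice.copy (ext G) (can_type ext_codeK).

Definition ext_le a b : bool :=
  match a, b with
  | NInf, _ | _, PInf => true
  | Fin x, Fin y => x <= y
  | _, _ => false
  end.

Fact ext_le_refl : reflexive ext_le.
Proof. by case=> //= x. Qed.

Fact ext_le_anti : antisymmetric ext_le.
Proof. by case=> [|x|] [|y|] //= /le_anti ->. Qed.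

Fact ext_le_trans : transitive ext_le.
Proof. by case=> [|x|] [|y|] [|z|] //=; apply: le_trans. Qed.

HB.instance Definition _ := Order.Le_isPOrder.Build ring_display (ext G)
  ext_le_refl ext_le_anti ext_le_trans.

Fact ext_le_total : total (@Order.le _ (ext G)).
Proof. by case=> [|x|] [|y|] //=; apply: oag_le_total. Qed.

HB.instance Definition _ :=
  Order.POrder_isTotal.Build ring_display (ext G) ext_le_total.

Definition ext_add a b : ext G :=
  match a, b with
  | NInf, _ | _, NInf => NInf
  | Fin x, Fin y => Fin (x + y)
  | _, _ => PInf
  end.

End ExtOrder.

Definition is_max d (T : porderType d) (A : set T) (m : T) : Prop :=
  A m /\ ubound A m.

Definition is_min d (T : porderType d) (A : set T) (m : T) : Prop :=
  A m /\ lbound A m.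

Record valuation (G : divOagType) (F : fieldType) (v : F -> ext G) : Prop :=
  Valuation {
    valuation0 : v 0 = PInf;
    valuation_fin : forall x, x != 0 -> exists g, v x = Fin g;
    valuationM : forall x y, v (x * y) = ext_add (v x) (v y);
    valuationD : forall x y, Order.min (v x) (v y) <= v (x + y)
  }.

Definition extends_val (G : divOagType) (F E : fieldType) (j : F -> E)
    (v : F -> ext G) (u : E -> ext G) : Prop :=
  forall x, u (j x) = v x.

Section AlgebraicClosure.
Variables (G : divOagType) (K : fieldType) (L : closedFieldType).
Variable iota : {rmorphism K -> L}.

Definition is_alg_closure : Prop := forall x : L, algebraicOver iota x.

(* [v] has at most one extension to the algebraic closure [L] (existence is
   automatic).  Every value of an extension has a positive multiple in the
   value group of [v], so each equivalence class of extensions of [v] contains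
   exactly one function with values in [ext G] that restricts to [v]. *)
Definition henselian (v : K -> ext G) : Prop :=
  forall v1 v2 : L -> ext G,
    valuation v1 -> valuation v2 ->
    extends_val iota v v1 -> extends_val iota v v2 ->
    v1 =1 v2.

Definition adjoin (theta : L) : set L :=
  [set x | exists p q : {poly K}, (map_poly iota q).[theta] != 0 /\
           x = (map_poly iota p).[theta] / (map_poly iota q).[theta]].

Definition has_dim (E : set L) (n : nat) : Prop :=
  exists e : 'I_n -> L, (forall i, E (e i)) /\
    forall x, E x -> exists! c : 'rV[K]_n, x = \sum_i iota (c 0 i) * e i.

(* [K(theta) : K]; the default 0 is only taken if this degree is infinite *)
Definition adegree (theta : L) : nat := xget 0%N [set n | has_dim (adjoin theta) n].

Variable vbar : L -> ext G.

Definition distinguished_pair (theta alpha : L) : Prop :=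
  [/\ (adegree alpha < adegree theta)%N,
      is_max [set vbar (theta - beta) | beta in
                [set beta | (adegree beta < adegree theta)%N]]
             (vbar (theta - alpha))
    & forall eta : L, (adegree eta < adegree alpha)%N ->
        vbar (theta - eta) < vbar (theta - alpha)].

Definition distinguished_poly_pair (g f : {poly K}) : Prop :=
  [/\ irreducible_poly g, irreducible_poly f
    & exists theta alpha : L,
        [/\ root (map_poly iota g) theta, root (map_poly iota f) alpha
          & distinguished_pair theta alpha]].

End AlgebraicClosure.

Section KeyPolynomials.
Variables (G : divOagType) (K : fieldType).
Implicit Types (w : {fraction {poly K}} -> ext G) (f Q : {poly K}).

Definition deg f : nat := (size f).-1.

Definition cst_frac (x : K) : {fraction {poly K}} := tofrac x%:P.

Definition pval w f : ext G := w (tofrac f).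

(* (w f - w (d_b f)) / b, equal to NInf when d_b f = 0 *)
Definition epsilon_term w f (b : nat) : ext G :=
  match pval w f, pval w f^`N(b) with
  | Fin x, Fin y => Fin (b%:R^-1 *: (x - y))
  | _, _ => NInf
  end.

Definition epsilon w f : ext G :=
  \big[Order.max/NInf]_(1 <= b < size f) epsilon_term w f b.

(* The range of [b] in [epsilon] loses nothing, since d_b f = 0 for larger b. *)
Lemma epsilonP w f : valuation w ->
  is_max [set epsilon_term w f b | b in [set b | (0 < b)%N]] (epsilon w f).
Proof.
move=> wV.
have tN b : (size f <= b)%N -> epsilon_term w f b = NInf.
  move=> le_fb; have d0 : f^`N(b) = 0.
    apply/polyP=> i; rewrite coef_nderivn coef0 nth_default ?mul0rn //.
    exact: leq_trans le_fb (leq_addr _ _).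
  rewrite /epsilon_term d0 /pval tofrac0 (valuation0 wV).
  by case: (w _).
split.
  rewrite /epsilon big_seq; apply: (big_ind (fun a => [set epsilon_term w f b |
    b in [set b | (0 < b)%N]] a)).
  - by exists (size f).+1 => //=; apply: tN.
  - by move=> a b Aa Ab; case: (leP a b).
  - by move=> i; rewrite mem_index_iota => /andP[i_gt0 _]; exists i.
move=> _ [b /= b_gt0 <-]; have [/tN->//|lt_bf] := leqP (size f) b.
rewrite /epsilon; have: b \in index_iota 1 (size f).
  by rewrite mem_index_iota b_gt0.
elim: (index_iota _ _) => // i s IHs; rewrite inE big_cons le_max.
by case/orP=> [/eqP<-|/IHs->]; rewrite ?lexx ?orbT.
Qed.

Definition is_ABKP w Q : Prop :=
  [/\ Q \is monic, (0 < deg Q)%N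
    & forall f, epsilon w Q <= epsilon w f -> (deg Q <= deg f)%N].

Definition qcoef Q f (i : nat) : {poly K} := (f %/ Q ^+ i) %% Q.

Lemma qexpansionE Q f : Q \is monic -> (0 < deg Q)%N ->
  f = \sum_(i < size f) qcoef Q f i * Q ^+ i.
Proof.
move=> Qm Q_gt0; have Q0 := monic_neq0 Qm.
have E n : f = \sum_(i < n) qcoef Q f i * Q ^+ i + (f %/ Q ^+ n) * Q ^+ n.
  elim: n => [|n IHn]; first by rewrite big_ord0 add0r expr0 divp1 mulr1.
  rewrite big_ord_recr /= -addrA {1}IHn; congr (_ + _).
  rewrite exprSr -divp_divl -exprSr exprS mulrA -mulrDl.
  by rewrite [in RHS]addrC -divp_eq.
rewrite [LHS](E (size f)) divp_small ?mul0r ?addr0 //.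
rewrite -(@prednK (size (Q ^+ _))) ?size_poly_gt0 ?expf_neq0 //.
by rewrite size_exp ltnS leq_pmull.
Qed.

Lemma size_qcoef Q f i : (0 < deg Q)%N -> (size (qcoef Q f i) < size Q)%N.
Proof.
by move=> Q_gt0; rewrite ltn_modp -size_poly_gt0 (leq_trans Q_gt0) // leq_pred.
Qed.

(* The coefficients [qcoef Q f i] with i >= size f vanish. *)
Definition trunc w Q f : ext G :=
  \big[Order.min/PInf]_(i < size f) pval w (qcoef Q f i * Q ^+ i).

Definition trunc_neq w Q : Prop := exists f, trunc w Q f != pval w f.

(* alpha(Q) is the minimum of this set, infinity if it is empty *)
Definition alpha_set w Q : set nat :=
  [set deg f | f in [set f | trunc w Q f < pval w f]].

Definition psi w Q : set {poly K} :=
  [set f | [/\ f \is monic, trunc w Q f < pval w f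
             & is_min (alpha_set w Q) (deg f)]].

End KeyPolynomials.

(* Main.v *)
From HB Require Import structures.
Require Import Defs.
From mathcomp Require Import all_boot all_order all_algebra.
From mathcomp Require Import all_field ring zify.
From mathcomp Require Import boolp classical_sets.

Set Implicit Arguments.
Unset Strict Implicit.
Unset Printing Implicit Defensive.

Import Order.TTheory GRing.Theory Num.Theory.

Local Open Scope ring_scope.

(** Both conditions are about the closeness [vbar (theta - b)] of a root [theta]
    of [F] to other elements [b] of [L], and about [epsilon].

    The bridge between [w] and [vbar] is [ABKP_root_val]: in degree less than
    [deg F], the valuation [w] is evaluation at [theta] followed by [vbar], for
    whichever root [theta].  For polynomials [f] and [g] of such degree, the
    remainder of [f * g] modulo [F] has the value of [f * g] ([ABKP_mod]), so [w]
    induces a valuation of the field K[X]/(F).  Chevalley's theorem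
    ([valuation_extends]) extends it to [L] along the embedding that sends X to
    [theta], and since K is henselian the result can only be [vbar].

    Consequently, for [g] nonconstant of degree less than [deg F], all terms of
    [epsilon w g] are read off the Taylor expansion of [g] at [theta], and
    [epsilon w g] is the closeness of [theta] to the closest root of [g]
    ([root_dist_le_epsilon] and [epsilon_le_root_dist]).  Suppose
    [deg Q < deg F], let [alpha] be a root of [Q] closest to [theta], let
    [r = vbar (theta - alpha) = epsilon w Q], and consider the ball of the [x]
    with [vbar (theta - x) >= r].  If the roots of the nonzero polynomials of degree
    less than [deg Q] lie outside this ball, then [trunc w Q f] is the minimum of
    [vbar (f x)] for [x] in the ball.  Half of this gives [trunc_ge]: in degree
    less than [deg F], truncation keeps the value of [f] if no root of [f] is
    closer to [theta] than [r].  The other half gives [epsilon_le_trunc]: in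
    degree at most [deg F], if truncation keeps the value of [f], this value
    bounds [f] on the ball, so Cauchy's estimates for the Taylor coefficients at
    [theta] give [epsilon w f <= r].

    If [(theta, alpha)] is distinguished, no element of degree less than [deg F]
    is closer to [theta] than [r], and none of degree less than [deg Q] is even
    as close, so truncation keeps the values in degree less than [deg F]; it
    lowers that of [F], because [epsilon w F > epsilon w Q = r].
    Conversely, if [F] has minimal degree among the polynomials whose value is
    lowered, then [epsilon w g <= r] for every [g] of smaller degree, so that no
    element of degree less than [deg F] is closer to [theta] than [r]; elements
    of degree less than [deg Q] are strictly farther away since [Q] is an
    abstract key polynomial. *)

(** * Values *)

Section Values.
Variable G : divOagType.
Implicit Types (x y z : G) (a b c d : ext G).

Lemma oag_lerD2r z x y : (x + z <= y + z) = (x <= y).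
Proof.
apply/idP/idP=> [/(oag_leD2r (- z))|]; first by rewrite !addrK.
exact: oag_leD2r.
Qed.

Lemma oag_lerD x y z t : x <= y -> z <= t -> x + z <= y + t.
Proof.
move=> xy zt; apply: (@le_trans _ _ (y + z)); first by rewrite oag_lerD2r.
by rewrite ![y + _]addrC oag_lerD2r.
Qed.

Lemma oag_mulrn_ge0 n x : 0 <= x -> 0 <= x *+ n.
Proof.
move=> x0; elim: n => [|n IHn]; first by rewrite mulr0n.
by rewrite mulrS -[0]addr0 oag_lerD.
Qed.

Lemma oag_mulrn_wge0 n x : (0 < n)%N -> 0 <= x *+ n -> 0 <= x.
Proof.
case: n => // n _ nx0; have /orP[//|x0] := oag_le_total 0 x.
suff le_nx : x *+ n.+1 <= x.
  by apply: le_trans nx0 le_nx.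
elim: n {nx0} => [|n IHn]; first by rewrite mulr1n.
by rewrite mulrS -[leRHS]addr0 [x + _]addrC oag_lerD // (le_trans IHn).
Qed.

Lemma oag_mulrn_inj n x y : (0 < n)%N -> x *+ n = y *+ n -> x = y.
Proof.
move=> n0 e; have h : (n%:R : rat) *: x = n%:R *: y by rewrite !scaler_nat.
by apply: scalerI h; rewrite pnatr_eq0 -lt0n.
Qed.

Lemma oag_scaleVK n x : (0 < n)%N -> (n%:R^-1 : rat) *: x *+ n = x.
Proof.
by move=> n0; rewrite -scaler_nat scalerA mulfV ?scale1r // pnatr_eq0 -lt0n.
Qed.

Lemma oag_lerMn2r n x y : (0 < n)%N -> (x *+ n <= y *+ n) = (x <= y).
Proof.
move=> n0; rewrite -(oag_lerD2r (- x) x) addrN.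
rewrite -(oag_lerD2r (- (x *+ n)) (x *+ n)) addrN -mulrnBl.
by apply/idP/idP; [apply: oag_mulrn_wge0 | apply: oag_mulrn_ge0].
Qed.

Lemma ext_leFin x y : (Fin x <= Fin y) = (x <= y). Proof. by []. Qed.

Lemma ext_addC : commutative (@ext_add G).
Proof. by case=> [|x|] [|y|] //=; rewrite addrC. Qed.

Lemma ext_addA : associative (@ext_add G).
Proof. by case=> [|x|] [|y|] [|z|] //=; rewrite addrA. Qed.

Lemma ext_addACA a b c d :
  ext_add (ext_add a b) (ext_add c d) = ext_add (ext_add a c) (ext_add b d).
Proof. by rewrite !ext_addA -(ext_addA a) (ext_addC b c) !ext_addA. Qed.

Lemma ext_add0 a : ext_add a (Fin 0) = a.
Proof. by case: a => //= x; rewrite addr0. Qed.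

Lemma ext_leD a b c d : a <= b -> c <= d -> ext_add a c <= ext_add b d.
Proof.
by case: a b c d => [|x|] [|y|] [|z|] [|t|] //=; apply: oag_lerD.
Qed.

Lemma ext_leD2r s a b : (ext_add a (Fin s) <= ext_add b (Fin s)) = (a <= b).
Proof. by case: a b => [|x|] [|y|] //=; apply: oag_lerD2r. Qed.

Lemma ext_ltD2r s a b : (ext_add a (Fin s) < ext_add b (Fin s)) = (a < b).
Proof. by rewrite !ltNge ext_leD2r. Qed.

Lemma ext_ltleD a b s d : a < b -> Fin s <= d -> ext_add a (Fin s) < ext_add b d.
Proof.
move=> ab sd; apply: (@lt_le_trans _ _ (ext_add b (Fin s))).
  by rewrite ext_ltD2r.
exact: ext_leD.
Qed.

Lemma ext_lex (a : ext G) : a <= PInf.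
Proof. by case: a. Qed.

End Values.

(** * Valuations on integral domains *)

(** Both a valuation of a field and the values that a valuation of the
    rational function field takes on polynomials are of this kind. *)
Definition ring_valuation (G : divOagType) (R : idomainType)
    (u : R -> ext G) : Prop :=
  [/\ u 0 = PInf,
      forall x, x != 0 -> exists g, u x = Fin g,
      forall x y, u (x * y) = ext_add (u x) (u y)
    & forall x y, Order.min (u x) (u y) <= u (x + y)].

Lemma valuation_ring (G : divOagType) (F : fieldType) (u : F -> ext G) :
  valuation u <-> ring_valuation u.
Proof. by split=> [[]|[]]; split. Qed.

Lemma pval_ring (G : divOagType) (K : fieldType)
    (w : {fraction {poly K}} -> ext G) : valuation w -> ring_valuation (pval w).
Proof.
case=> w0 wfin wM wD; split=> [|p p0|p q|p q]; rewrite /pval.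
- by rewrite tofrac0.
- by apply: wfin; rewrite tofrac_eq0.
- by rewrite tofracM.
- by rewrite tofracD.
Qed.

Section RingValuation.
Variables (G : divOagType) (R : idomainType) (u : R -> ext G).
Hypothesis uV : ring_valuation u.
Implicit Types x y z t : R.

Lemma rv0 : u 0 = PInf. Proof. by case: uV. Qed.
Lemma rv_fin x : x != 0 -> exists g, u x = Fin g. Proof. by case: uV => _ /(_ x). Qed.
Lemma rvM x y : u (x * y) = ext_add (u x) (u y). Proof. by case: uV. Qed.

Lemma rv_lt_pinf x : x != 0 -> u x < PInf.
Proof. by case/rv_fin=> g ->. Qed.

Lemma rv1 : u 1 = Fin 0.
Proof.
have [g g1] := rv_fin (oner_neq0 R).
have := rvM 1 1; rewrite mulr1 g1 /= => -[/eqP].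
by rewrite -[eqbLHS]addr0 (inj_eq (addrI g)) => /eqP <-.
Qed.

Lemma rvN x : u (- x) = u x.
Proof.
suff uN1 : u (-1) = Fin 0.
  rewrite -mulN1r rvM uN1.
  by have [->|/rv_fin[g ->]] := eqVneq x 0; rewrite ?rv0 //= add0r.
have [g ug] : exists g, u (-1) = Fin g by apply: rv_fin; rewrite oppr_eq0 oner_eq0.
have := rvM (-1) (-1); rewrite mulrNN mulr1 rv1 ug /= => -[].
by rewrite -mulr2n => e; congr Fin; apply: (@oag_mulrn_inj _ 2); rewrite // -e mul0rn.
Qed.

Lemma rvD m x y : m <= u x -> m <= u y -> m <= u (x + y).
Proof.
case: uV => _ _ _ h mx my; apply: le_trans (h x y).
by rewrite le_min mx my.
Qed.

Lemma rvD_shift m s x y : m <= ext_add (u x) (Fin s) -> m <= ext_add (u y) (Fin s) ->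
  m <= ext_add (u (x + y)) (Fin s).
Proof.
case: uV => _ _ _ /(_ x y) h mx my.
apply: (@le_trans _ _ (ext_add (Order.min (u x) (u y)) (Fin s))).
  by case: (leP (u x) (u y)).
by rewrite ext_leD2r.
Qed.

Lemma rvB m x y : m <= u x -> m <= u y -> m <= u (x - y).
Proof. by move=> mx my; apply: rvD => //; rewrite rvN. Qed.

Lemma rvD_lt m x y : m < u x -> m < u y -> m < u (x + y).
Proof.
case: uV => _ _ _ h mx my; apply: lt_le_trans (h x y).
by rewrite lt_min mx my.
Qed.

Lemma rv_sum (I : Type) (r : seq I) (P : pred I) (E : I -> R) m :
  (forall i, P i -> m <= u (E i)) -> m <= u (\sum_(i <- r | P i) E i).
Proof.
move=> mE; apply: (big_ind (fun x => m <= u x)) => //; last by move=> x y; apply: rvD.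
by rewrite rv0 ext_lex.
Qed.

Lemma rv_sum_lt (I : Type) (r : seq I) (P : pred I) (E : I -> R) m : m < PInf ->
  (forall i, P i -> m < u (E i)) -> m < u (\sum_(i <- r | P i) E i).
Proof.
move=> m_fin mE; apply: (big_ind (fun x => m < u x)) => //; last by move=> x y; apply: rvD_lt.
by rewrite rv0.
Qed.

Lemma rvDl x y : u x < u y -> u (x + y) = u x.
Proof.
move=> xy; apply/le_anti/andP; split; last by apply: rvD => //; apply: ltW.
rewrite leNgt; apply/negP => lt_x.
have : u x < u (x + y - y) by apply: rvD_lt; rewrite ?rvN.
by rewrite addrK ltxx.
Qed.

Lemma rv_subC x y : u (x - y) = u (y - x).
Proof. by rewrite -rvN opprB. Qed.

Lemma rv_leM x y z t : u x <= u y -> u z <= u t -> u (x * z) <= u (y * t).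
Proof. by rewrite !rvM; apply: ext_leD. Qed.

Lemma rv_ltleM x y z t : u x < u y -> u z <= u t -> z != 0 ->
  u (x * z) < u (y * t).
Proof. by rewrite !rvM => xy zt /rv_fin[g ug]; move: zt; rewrite ug; apply: ext_ltleD. Qed.

Lemma rv_exp_fin x g n : u x = Fin g -> u (x ^+ n) = Fin (g *+ n).
Proof.
move=> ux; elim: n => [|n IHn]; first by rewrite rv1.
by rewrite exprS rvM ux IHn mulrS.
Qed.

End RingValuation.

(** * Chevalley's extension theorem *)

Section Chevalley.
Variable L : fieldType.
Implicit Types (A I : set L) (x y : L) (p q : {poly L}).

(** A subring of [L] with a proper ideal.  The pairs that are maximal for
    inclusion of both components are the valuation rings of [L] with their
    maximal ideals. *)
Record proper_pair A I : Prop := ProperPair {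
  pp1 : A 1;
  ppB : forall x y, A x -> A y -> A (x - y);
  ppM : forall x y, A x -> A y -> A (x * y);
  ppI : forall x, I x -> A x;
  pp0 : I 0;
  ppID : forall x y, I x -> I y -> I (x + y);
  ppIM : forall x y, A x -> I y -> I (x * y);
  ppI1 : ~ I 1
}.

Definition coefs_in A p : Prop := forall i, A p`_i.

Section Closure.
Variables (A I : set L).
Hypothesis AI : proper_pair A I.

Lemma ppN x : A x -> A (- x).
Proof.
have A0 : A 0 by exact: (ppI AI (pp0 AI)).
by move=> Ax; rewrite -sub0r; apply: (ppB AI).
Qed.

Lemma ppD x y : A x -> A y -> A (x + y).
Proof. by move=> Ax /ppN Ay; rewrite -[y]opprK; apply: (ppB AI). Qed.

Lemma pp_exp x n : A x -> A (x ^+ n).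
Proof.
move=> Ax; elim: n => [|n IHn]; first exact: (pp1 AI).
by rewrite exprS; apply: (ppM AI).
Qed.

Lemma pp_sumI (J : Type) (r : seq J) (P : pred J) (E : J -> L) :
  (forall j, P j -> I (E j)) -> I (\sum_(j <- r | P j) E j).
Proof.
by move=> IE; apply: (big_ind I) => //; [exact: (pp0 AI)|exact: (ppID AI)].
Qed.

Lemma pp_sumA (J : Type) (r : seq J) (P : pred J) (E : J -> L) :
  (forall j, P j -> A (E j)) -> A (\sum_(j <- r | P j) E j).
Proof.
move=> AE; apply: (big_ind A) => //; last exact: ppD.
exact: (ppI AI (pp0 AI)).
Qed.

(** Adjoining an element and extending the ideal can only destroy properness:
    this turns maximality of a pair into relations over its ideal. *)
Lemma adjoin_proper_pair x :
    ~ (exists2 p, coefs_in I p & p.[x] = 1) ->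
  proper_pair [set p.[x] | p in coefs_in A] [set p.[x] | p in coefs_in I].
Proof.
move=> nI1; have A0 : A 0 by exact: (ppI AI (pp0 AI)).
have cC (B : set L) c : B 0 -> B c -> coefs_in B c%:P.
  by move=> B0 Bc i; rewrite coefC; case: eqP.
split.
- by exists 1; rewrite ?hornerC // -[1]/(1%:P); apply: cC => //; apply: (pp1 AI).
- move=> _ _ [p pA <-] [q qA <-]; exists (p - q); last by rewrite hornerD hornerN.
  by move=> i; rewrite coefB; apply: (ppB AI).
- move=> _ _ [p pA <-] [q qA <-]; exists (p * q); last by rewrite hornerM.
  by move=> i; rewrite coefM; apply: pp_sumA => j _; apply: (ppM AI).
- by move=> _ [p pI <-]; exists p => // i; apply: (ppI AI).
- by exists 0; rewrite ?hornerC // => i; rewrite coef0; apply: (pp0 AI).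
- move=> _ _ [p pA <-] [q qA <-]; exists (p + q); last by rewrite hornerD.
  by move=> i; rewrite coefD; apply: (ppID AI).
- move=> _ _ [p pA <-] [q qA <-]; exists (p * q); last by rewrite hornerM.
  by move=> i; rewrite coefM; apply: pp_sumI => j _; apply: (ppIM AI).
- by move=> [p pI p1]; apply: nI1; exists p.
Qed.

End Closure.

Lemma proper_pair_maximal A0 I0 : proper_pair A0 I0 ->
  exists A I, [/\ proper_pair A I, (A0 `<=` A)%classic, (I0 `<=` I)%classic &
    forall A' I', proper_pair A' I' -> (A `<=` A')%classic ->
      (I `<=` I')%classic -> (A' `<=` A)%classic].
Proof.
move=> AI0.
pose ring_part (S : set (bool * L)) : set L := fun x => S (true, x).
pose ideal_part (S : set (bool * L)) : set L := fun x => S (false, x).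
pose above S := [/\ proper_pair (ring_part S) (ideal_part S),
  (A0 `<=` ring_part S)%classic & (I0 `<=` ideal_part S)%classic].
(* [set0] is admitted because Zorn's lemma also asks for the union of the empty
   chain *)
pose P S := S = set0 \/ above S.
pose glue (A I : set L) : set (bool * L) := fun z => if z.1 then A z.2 else I z.2.
have [] := @Zorn_bigcup _ P.
  move=> C CP Ctot; set U := (\bigcup_(X in C) X)%classic.
  have common (z t : bool * L) : U z -> U t -> exists X, [/\ C X, above X, X z & X t].
    have Cab X (y : bool * L) : C X -> X y -> above X.
      by move=> CX Xy; case: (CP X CX) Xy => // ->.
    move=> [X CX Xz] [Y CY Yt]; have [XY|YX] := Ctot X Y CX CY.
      by exists Y; split; [|exact: Cab Yt|exact: XY|].
    by exists X; split; [|exact: Cab Xz| |exact: YX].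
  have [[z Uz]|U0] := pselect (exists z, U z); last first.
    by left; apply/seteqP; split=> // z Uz; case: U0; exists z.
  right; have [X [CX [XV AX IX] _ _]] := common _ _ Uz Uz.
  have sub (y : bool * L) : X y -> U y by move=> Xy; exists X.
  split; first split.
  - by apply: sub; apply: (pp1 XV).
  - move=> x y Ax Ay; have [Y [CY [YV _ _] Yx Yy]] := common _ _ Ax Ay.
    by exists Y => //; apply: (ppB YV).
  - move=> x y Ax Ay; have [Y [CY [YV _ _] Yx Yy]] := common _ _ Ax Ay.
    by exists Y => //; apply: (ppM YV).
  - move=> x Ax; have [Y [CY [YV _ _] Yx Yy]] := common _ _ Ax Ax.
    by exists Y => //; apply: (ppI YV).
  - by apply: sub; apply: (pp0 XV).
  - move=> x y Ax Ay; have [Y [CY [YV _ _] Yx Yy]] := common _ _ Ax Ay.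
    by exists Y => //; apply: (ppID YV).
  - move=> x y Ax Ay; have [Y [CY [YV _ _] Yx Yy]] := common _ _ Ax Ay.
    by exists Y => //; apply: (ppIM YV).
  - by move=> U1; have [Y [CY [YV _ _] Yx Yy]] := common _ _ U1 U1; case: (ppI1 YV).
  - by move=> x /AX; apply: sub.
  - by move=> x /IX; apply: sub.
move=> S [PS Smax]; have [S0|[SV AS IS]] := PS.
  case: (Smax (glue A0 I0)); last by right; split.
  by rewrite S0; split=> // /(_ (true, 1)) /=; apply; apply: (pp1 AI0).
exists (ring_part S), (ideal_part S); split=> // A' I' AI' AA' II' x A'x.
apply: contrapT => nAx; case: (Smax (glue A' I')); last first.
  by right; split=> // y => [/AS /AA'|/IS /II'].
split=> [[[] y]|/(_ (true, x))] //=; first exact: AA'.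
  exact: II'.
by move/(_ A'x).
Qed.

Lemma exprV_sub x k n : x != 0 -> (k <= n)%N -> x^-1 ^+ k * x ^+ n = x ^+ (n - k).
Proof.
move=> x0 le_kn; rewrite -{1}(subnK le_kn) addnC exprD mulrA -exprMn mulVf //.
by rewrite expr1n mul1r.
Qed.

Section Maximal.
Variables A I : set L.
Hypothesis AI : proper_pair A I.
Hypothesis AImax : forall A' I', proper_pair A' I' -> (A `<=` A')%classic ->
  (I `<=` I')%classic -> (A' `<=` A)%classic.

(** Otherwise [x] could be adjoined to [A].  Such a [p] is called below a relation
    for [x] over [I]. *)
Lemma maximal_notin x : ~ A x -> exists2 p, coefs_in I p & p.[x] = 1.
Proof.
move=> nAx; apply: contrapT => /(adjoin_proper_pair AI) AIx.
have I0 := pp0 AI; have A0 := ppI AI I0.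
have cst (B : set L) c : B 0 -> B c -> [set p.[x] | p in coefs_in B]%classic c.
  by move=> B0 Bc; exists c%:P; rewrite ?hornerC // => i; rewrite coefC; case: eqP.
apply: nAx; apply: (AImax AIx).
- by move=> c Ac; apply: cst.
- by move=> c Ic; apply: cst.
exists 'X; rewrite ?hornerX // => i; rewrite coefX.
by case: eqP => // _; apply: (pp1 AI).
Qed.

(** A relation over [I] for the inverse of [1 - i], cleared of denominators,
    would put a power of [1 - i] into [I], though it is congruent to 1. *)
Lemma maximal_unit i : I i -> A (1 - i)^-1.
Proof.
move=> Ii; set s := 1 - i; have As : A s by apply: (ppB AI (pp1 AI)); apply: (ppI AI).
have s0 : s != 0.
  by apply/eqP => /subr0_eq i1; apply: (ppI1 AI); rewrite i1.
apply: contrapT => /maximal_notin[p pI p1]; apply: (ppI1 AI).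
pose n := size p; rewrite -[1](addrNK (s ^+ n)); apply: (ppID AI).
  rewrite -opprB subrX1 -mulNr opprB subKr mulrC; apply: (ppIM AI) => //.
  by apply: (pp_sumA AI) => // j _; apply: (pp_exp AI).
rewrite -[s ^+ n]mulr1 -p1 horner_coef mulr_sumr; apply: (pp_sumI AI) => j _.
have -> : s ^+ n * (p`_j * s^-1 ^+ j) = s ^+ (n - j) * p`_j.
  by rewrite -exprV_sub 1?ltnW // mulrCA mulrC [_ * s ^+ n]mulrC.
by apply: (ppIM AI) => //; apply: (pp_exp AI).
Qed.

Let span x n : set L := [set y | exists p, [/\ (size p <= n)%N, coefs_in I p & p.[x] = y]].

Let spanD x n y z : span x n y -> span x n z -> span x n (y + z).
Proof.
move=> [p [sp pI <-]] [q [sq qI <-]]; exists (p + q); split.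
- by rewrite (leq_trans (size_polyD _ _)) // geq_max sp.
- by move=> i; rewrite coefD; apply: (ppID AI).
- by rewrite hornerD.
Qed.

Let spanZ x n a y : A a -> span x n y -> span x n (a * y).
Proof.
move=> Aa [p [sp pI <-]]; exists (a *: p); split; last by rewrite hornerZ.
  by rewrite (leq_trans (size_scale_leq _ _)).
by move=> i; rewrite coefZ; apply: (ppIM AI).
Qed.

Let span_mono x n i a : (i < n)%N -> I a -> span x n (a * x ^+ i).
Proof.
move=> lt_in Ia; exists (a *: 'X^i); split; last by rewrite hornerZ hornerXn.
  by rewrite (leq_trans (size_scale_leq _ _)) // size_polyXn.
by move=> j; rewrite coefZ coefXn; case: eqP => _;
  rewrite ?mulr1 // mulr0; apply: (pp0 AI).
Qed.

Let span_sum x n (J : Type) (r : seq J) (P : pred J) (E : J -> L) :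
  (forall j, P j -> span x n (E j)) -> span x n (\sum_(j <- r | P j) E j).
Proof.
move=> h; apply: (big_ind (span x n)) => //; last exact: spanD.
exists 0; rewrite size_poly0 horner0; split=> // i.
by rewrite coef0; apply: (pp0 AI).
Qed.

(** Euclid's step: a relation for [x^-1] of no greater degree lowers the degree
    of a relation for [x]. *)
Let span_decr x n m : x != 0 -> (m <= n)%N -> span x n.+1 1 -> span x^-1 m.+1 1 ->
  span x n 1.
Proof.
move=> x0 le_mn [p [sp pI p1]] [q [sq qI q1]].
have Xn : span x n (x ^+ n).
  have s_unit := maximal_unit (qI 0); have Iq := qI; have := q1.
  have s0 : 1 - q`_0 != 0.
    by apply/eqP => /subr0_eq q01; apply: (ppI1 AI); rewrite q01; apply: qI.
  rewrite (horner_coef_wide _ sq) big_ord_recl expr0 mulr1 => /esym/eqP.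
  rewrite addrC -subr_eq => /eqP s_sum.
  rewrite -[x ^+ n](mulKf s0) [X in _ * (X * _)]s_sum; apply: spanZ => //; rewrite mulr_suml.
  apply: span_sum => j _; rewrite -mulrA exprV_sub //.
    apply: span_mono => //; rewrite lift0 ltn_subrL /=.
    by rewrite (leq_trans _ le_mn) // (leq_ltn_trans _ (ltn_ord j)).
  by rewrite lift0 (leq_trans _ le_mn).
rewrite -p1 (horner_coef_wide _ sp) big_ord_recr /=; apply: spanD.
  by apply: span_sum => j _; apply: span_mono.
by apply: spanZ => //; apply: (ppI AI).
Qed.

(** If neither [x] nor its inverse were in [A], both would satisfy relations over
    [I], and the one of larger degree could be shortened by the other. *)
Lemma maximal_valuation_ring x : A x \/ A x^-1.
Proof.
have [->|x0] := eqVneq x 0; first by left; apply: (ppI AI); apply: (pp0 AI).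
apply: contrapT => /not_orP[nAx nAx'].
have span1 y : ~ A y -> exists n, span y n 1.
  by case/maximal_notin=> p pI p1; exists (size p), p.
have no_span0 y : ~ span y 0 1.
  move=> [p [p0 _]]; move: p0; rewrite leqn0 size_poly_eq0 => /eqP ->.
  by rewrite horner0 => /esym/eqP; rewrite oner_eq0.
have [k] : exists k, exists n m, [/\ (n + m <= k)%N, span x n 1 & span x^-1 m 1].
  have [n xn] := span1 _ nAx; have [m xm] := span1 _ nAx'.
  by exists (n + m)%N, n, m.
elim: k => [|k IHk] [[|n] [[|m] [//]]] le_k xn xm; try exact: no_span0 xn; try exact: no_span0 xm.
have [le_mn|/ltnW le_nm] := leqP m n.
  apply: IHk; exists n, m.+1; split=> //.
  exact: span_decr xn xm.
apply: IHk; exists n.+1, m; split=> //; first by rewrite -ltnS -addnS.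
by apply: (@span_decr x^-1 m n); rewrite ?invr_eq0 ?invrK.
Qed.

End Maximal.
End Chevalley.

Section Extension.
Variables (G : divOagType) (E L : fieldType) (j : {rmorphism E -> L}).
Variable u : E -> ext G.
Hypothesis uV : valuation u.
Hypothesis L_alg : forall x : L, algebraicOver j x.

Let uR : ring_valuation u. Proof. exact/valuation_ring. Qed.

Let neg_inv a : u a < Fin 0 -> Fin 0 < u a^-1.
Proof.
have [->|a0] := eqVneq a 0; first by rewrite (rv0 uR).
move=> ua; rewrite ltNge; apply/negP => uaV.
have aV0 : a^-1 != 0 by rewrite invr_eq0.
have := rvM uR a a^-1; rewrite mulfV // (rv1 uR).
have [g ug] := rv_fin uR a0; have [h uh] := rv_fin uR aV0.
move: ua uaV; rewrite ug uh => ua uaV e.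
have : Fin (g + h) < Fin (0 + 0) by apply: (ext_ltleD ua) uaV.
by rewrite addr0; case: e => <-; rewrite ltxx.
Qed.

Let proper_pair_valuation :
  proper_pair [set j a | a in [set a | Fin 0 <= u a]]
              [set j a | a in [set a | Fin 0 < u a]].
Proof.
split.
- by exists 1; rewrite /= ?rmorph1 ?(rv1 uR).
- by move=> _ _ [a ua <-] [b ub <-]; exists (a - b); rewrite ?rmorphB //=; apply: rvB.
- move=> _ _ [a ua <-] [b ub <-]; exists (a * b); rewrite ?rmorphM //= (rvM uR).
  by have := ext_leD ua ub; rewrite /= addr0.
- by move=> _ [a ua <-]; exists a => //; apply: ltW.
- by exists 0; rewrite ?rmorph0 //= (rv0 uR).
- by move=> _ _ [a ua <-] [b ub <-]; exists (a + b); rewrite ?rmorphD //=; apply: rvD_lt.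
- move=> _ _ [a ua <-] [b ub <-]; exists (a * b); rewrite ?rmorphM //= mulrC (rvM uR).
  by have := ext_ltleD ub ua; rewrite /= addr0.
- by move=> [a /= ua /eqP]; rewrite fmorph_eq1 => /eqP a1; move: ua; rewrite a1 (rv1 uR) ltxx.
Qed.

Section ValuationRing.
Variable A : set L.
Hypotheses (A1 : A 1) (AD : forall x y, A x -> A y -> A (x + y)).
Hypotheses (AN : forall x, A x -> A (- x)) (AM : forall x y, A x -> A y -> A (x * y)).
Hypothesis Atot : forall x, A x \/ A x^-1.
Hypothesis Aj : forall a, A (j a) <-> Fin 0 <= u a.

Let unit x := [/\ x != 0, A x & A x^-1].

Let AX x n : A x -> A (x ^+ n).
Proof. by move=> Ax; elim: n => [|n IHn] //; rewrite exprS; apply: AM. Qed.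

Let unitM x y : unit x -> unit y -> unit (x * y).
Proof.
by move=> [x0 Ax AVx] [y0 Ay AVy]; split; rewrite ?mulf_neq0 ?invfM //; apply: AM.
Qed.

Let unitV x : unit x -> unit x^-1.
Proof. by move=> [x0 Ax AVx]; split; rewrite ?invr_eq0 ?invrK. Qed.

Let unitX x n : unit x -> unit (x ^+ n).
Proof.
by move=> [x0 Ax AVx]; split; rewrite ?expf_neq0 -?exprVn //; apply: AX.
Qed.

Let unit_val c : unit (j c) -> u c = Fin 0.
Proof.
move=> [c0 /Aj uc]; rewrite -fmorphV => /Aj uVc; apply/le_anti; rewrite uc andbT.
rewrite leNgt; apply/negP => lt_c.
have : Fin (0 + 0) < ext_add (u c) (u c^-1) by apply: ext_ltleD lt_c uVc.
by rewrite -(rvM uR) addr0 mulfV -?(fmorph_eq0 j) // (rv1 uR) ltxx.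
Qed.

(** [x] should have value [g]: some power of [x] is, up to a unit of the
    valuation ring, an element of the ground field of the right value. *)
Let has_val x g := exists n c, [/\ (0 < n)%N, c != 0, u c = Fin (g *+ n) & unit (x ^+ n / j c)].

Let has_val_uniq x g h : has_val x g -> has_val x h -> g = h.
Proof.
move=> [n [c [n0 c0 uc Uc]]] [m [d [m0 d0 ud Ud]]].
have x0 : x != 0.
  by case: Uc => + _ _; rewrite mulf_eq0 expf_eq0 n0; apply: contra => ->.
have : unit (j (d ^+ n / c ^+ m)).
  have := unitM (unitX m Uc) (unitV (unitX n Ud)).
  have -> // : (x ^+ n / j c) ^+ m * ((x ^+ m / j d) ^+ n)^-1 = j (d ^+ n / c ^+ m).
  rewrite fmorph_div !rmorphXn !expr_div_n -!exprM [(m * n)%N]mulnC.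
  have xnm0 : x ^+ (n * m) != 0 by rewrite expf_neq0.
  have jcm0 : j c ^+ m != 0 by rewrite expf_neq0 // fmorph_eq0.
  have jdn0 : j d ^+ n != 0 by rewrite expf_neq0 // fmorph_eq0.
  by rewrite invf_div mulrC mulrA divfK.
move/unit_val => e.
have cm0 : c ^+ m != 0 by rewrite expf_neq0.
have := rvM uR (c ^+ m) (d ^+ n / c ^+ m).
rewrite e mulrCA mulfV // mulr1.
rewrite (rv_exp_fin uR n ud) (rv_exp_fin uR m uc) /= addr0 => -[/esym].
by rewrite -!mulrnA mulnC; apply: oag_mulrn_inj; rewrite muln_gt0 m0.
Qed.

Let has_valM x y g h : has_val x g -> has_val y h -> has_val (x * y) (g + h).
Proof.
move=> [n [c [n0 c0 uc Uc]]] [m [d [m0 d0 ud Ud]]].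
exists (n * m)%N, (c ^+ m * d ^+ n); split.
- by rewrite muln_gt0 n0.
- by rewrite mulf_neq0 // expf_neq0.
- by rewrite (rvM uR) (rv_exp_fin uR m uc) (rv_exp_fin uR n ud) /= -!mulrnA mulrnDl (mulnC m).
have := unitM (unitX m Uc) (unitX n Ud).
have -> // : (x ^+ n / j c) ^+ m * (y ^+ m / j d) ^+ n =
   (x * y) ^+ (n * m) / j (c ^+ m * d ^+ n).
by rewrite rmorphM !rmorphXn !expr_div_n exprMn -!exprM [(m * n)%N]mulnC mulrACA invfM.
Qed.

Let has_val_ge0 x g : has_val x g -> A x <-> 0 <= g.
Proof.
move=> [n [c [n0 c0 uc Uc]]]; have [_ Axc Acx] := Uc.
have jc0 : j c != 0 by rewrite fmorph_eq0.
split=> [Ax|g0].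
  have : A (j c).
    have [/mulfV xx _ _] := Uc.
    rewrite -[j c]mul1r -xx mulrAC divfK //.
    by apply: AM => //; apply: AX.
  by move/Aj; rewrite uc; apply: oag_mulrn_wge0.
have Axn : A (x ^+ n).
  rewrite -(divfK jc0 (x ^+ n)); apply: AM => //; apply/Aj.
  by rewrite uc; apply: oag_mulrn_ge0.
have [//|AVx] := Atot x.
case: n n0 {uc Uc Axc Acx} Axn => // n _ Axn.
have [->|x0] := eqVneq x 0; first by rewrite -(subrr 1); apply: AD => //; apply: AN.
have -> : x = x ^+ n.+1 * x^-1 ^+ n.
  by rewrite exprVn exprS mulfK // expf_neq0.
by apply: AM => //; apply: AX.
Qed.

(** In a vanishing sum of nonzero terms, divide by a term that divides all
    others: another quotient must be a unit, as nonunits form an ideal. *)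
Let associated_terms (s : seq nat) (t : nat -> L) : uniq s -> s != [::] ->
    (forall k, k \in s -> t k != 0) -> \sum_(k <- s) t k = 0 ->
  exists k i, k != i /\ [/\ k \in s, i \in s & unit (t k / t i)].
Proof.
move=> s_uniq s_n0 t0 sum0.
have [i si Ai] : exists2 i, i \in s & forall k, k \in s -> A (t k / t i).
  elim: s s_n0 t0 {s_uniq sum0} => // k s IHs _ t0.
  have [->|s_n0] := eqVneq s [::].
    exists k; rewrite ?mem_head // => l; rewrite inE => /eqP ->.
    by rewrite mulfV // t0 // mem_head.
  have t0s l : l \in s -> t l != 0 by move=> sl; rewrite t0 // inE sl orbT.
  have [i si Ai] := IHs s_n0 t0s.
  have [Aki|Aik] := Atot (t k / t i).
    exists i => [|l]; first by rewrite inE si orbT.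
    by rewrite inE => /orP[/eqP->|/Ai].
  exists k; rewrite ?mem_head // => l; rewrite inE => /orP[/eqP->|/Ai Ali].
    by rewrite mulfV // t0 // mem_head.
  have -> : t l / t k = t l / t i * (t k / t i)^-1.
    by rewrite invf_div mulrA divfK // t0s.
  exact: AM.
apply: contrapT => noassoc.
pose M y := A y /\ ~ unit y.
have MD y z : M y -> M z -> M (y + z).
  move=> [Ay nUy] [Az nUz]; split; first exact: AD.
  have [->|y0] := eqVneq y 0; first by rewrite add0r.
  have [->|z0] := eqVneq z 0; first by rewrite addr0.
  move=> [yz0 _ AVyz]; have [Ayz|Azy] := Atot (y / z).
    apply: nUz; split=> //.
    have -> : z^-1 = (y / z + 1) * (y + z)^-1.
      by rewrite -[1](mulfV z0) -mulrDl mulrAC mulfV // mul1r.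
    by apply: AM => //; apply: AD.
  apply: nUy; split=> //; rewrite invf_div in Azy.
  have -> : y^-1 = (1 + z / y) * (y + z)^-1.
    by rewrite -[1](mulfV y0) -mulrDl mulrAC mulfV // mul1r.
  by apply: AM => //; apply: AD.
have : M (\sum_(k <- s | k != i) t k / t i).
  rewrite big_seq_cond; apply: (big_ind M) => //.
    split; last by case; rewrite eqxx.
    by rewrite -(subrr 1); apply: AD => //; apply: AN.
  move=> k /andP[sk ki]; split; first exact: Ai.
  by move=> Uki; apply: noassoc; exists k, i.
have -> : \sum_(k <- s | k != i) t k / t i = -1.
  have := congr1 ( *%R^~ (t i)^-1) sum0; rewrite mul0r mulr_suml.
  rewrite (bigD1_seq i) //= mulfV ?t0 // => /eqP.
  by rewrite addrC addr_eq0 => /eqP.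
by case=> _; case; split; rewrite ?oppr_eq0 ?oner_eq0 ?invrN ?invr1 //; apply: AN.
Qed.

Let has_val_total x : x != 0 -> exists g, has_val x g.
Proof.
move=> x0; have [p p0] := L_alg x.
rewrite /root horner_coef size_map_poly => /eqP sum0.
pose t i := j p`_i * x ^+ i; pose s := [seq i <- index_iota 0 (size p) | p`_i != 0].
have ts : \sum_(i <- s) t i = 0.
  rewrite -[RHS]sum0 big_filter big_mkcond big_mkord.
  apply: eq_bigr => i _; rewrite /t coef_map /=.
  by case: eqP => //= ->; rewrite rmorph0 mul0r.
have st k : k \in s -> p`_k != 0 by rewrite mem_filter => /andP[].
have [||k sk|k [i [ki [sk si Uki]]]] := @associated_terms s t _ _ _ ts.
- by rewrite filter_uniq // iota_uniq.
- apply/eqP => s0; have : (size p).-1 \in s.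
    by rewrite mem_filter -lead_coefE lead_coef_eq0 p0 mem_index_iota /= prednK ?size_poly_gt0.
  by rewrite s0.
- by rewrite /t mulf_neq0 ?fmorph_eq0 ?st // expf_neq0.
wlog lt_ik : k i sk si Uki {ki} / (i < k)%N.
  move=> wl; move: ki; rewrite neq_ltn => /orP[lt_ki|]; last exact: wl Uki.
  by apply: (wl i k) => //; rewrite -invf_div; apply: unitV.
have c0 : p`_i / p`_k != 0 by rewrite mulf_neq0 ?invr_eq0 ?st.
have [g ug] := rv_fin uR c0; exists ((k - i)%:R^-1 *: g : G), (k - i)%N, (p`_i / p`_k).
have ki0 : (0 < k - i)%N by rewrite subn_gt0.
split=> //.
  by rewrite ug oag_scaleVK.
have -> // : x ^+ (k - i) / j (p`_i / p`_k) = t k / t i.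
rewrite /t fmorph_div invf_div invfM mulrACA expfB //.
by rewrite mulrC.
Qed.

Lemma valuation_of_ring : exists u' : L -> ext G, valuation u' /\ extends_val j u u'.
Proof.
pose u' x := if x == 0 then PInf else Fin (xget 0 (has_val x)).
have u'E x g : has_val x g -> u' x = Fin g.
  move=> xg; rewrite /u'; case: eqP => [x0|_].
    move: xg => [n [c [n0 c0 _ [+ _ _]]]].
    by rewrite x0 expr0n eqn0Ngt n0 mul0r eqxx.
  by congr Fin; apply: (@has_val_uniq x) => //; case: xgetP => // /(_ _ xg).
have u'0 : u' 0 = PInf by rewrite /u' eqxx.
exists u'; split; first split=> //.
- by move=> x /has_val_total[g xg]; exists g; apply: u'E.
- move=> x y; have [->|x0] := eqVneq x 0.
    rewrite mul0r u'0; have [->|/has_val_total[g /u'E ->] //] := eqVneq y 0.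
    by rewrite u'0.
  have [g xg] := has_val_total x0; rewrite (u'E _ _ xg).
  have [->|/has_val_total[h yh]] := eqVneq y 0; first by rewrite mulr0 u'0.
  by rewrite (u'E _ _ yh); apply: u'E; apply: has_valM.
- move=> x y.
  wlog [g [xg le_xy]] : x y / exists g, has_val x g /\ A (y / x).
    move=> wl; have [->|x0] := eqVneq x 0; first by rewrite add0r ge_min lexx orbT.
    have [->|y0] := eqVneq y 0; first by rewrite addr0 ge_min lexx.
    have [Ayx|] := Atot (y / x).
      by have [g xg] := has_val_total x0; apply: wl; exists g.
    rewrite invf_div => Axy; have [g yg] := has_val_total y0.
    by rewrite addrC minC; apply: wl; exists g.
  have x0 : x != 0.
    move: xg => [n [c [n0 _ _ [+ _ _]]]]; apply: contraNneq => ->.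
    by rewrite expr0n eqn0Ngt n0 mul0r.
  rewrite (u'E _ _ xg) ge_min; apply/orP; left.
  have -> : x + y = (1 + y / x) * x by rewrite mulrDl mul1r divfK.
  have [->|/has_val_total[h zh]] := eqVneq (1 + y / x) 0.
    by rewrite mul0r u'0 ext_lex.
  rewrite (u'E _ _ (has_valM zh xg)); rewrite -[X in Fin X <= _]add0r.
  suff h0 : 0 <= h by apply: oag_lerD.
  by apply/(has_val_ge0 zh); apply: AD.
move=> c; have [->|c0] := eqVneq c 0; first by rewrite rmorph0 u'0 (rv0 uR).
have [g ug] := rv_fin uR c0; rewrite ug; apply: u'E.
by exists 1%N, c; split; rewrite // expr1 mulfV ?fmorph_eq0 //; split; rewrite ?oner_eq0 ?invr1.
Qed.

End ValuationRing.

(** A maximal pair above the valuation ring of [u] is a valuation ring of [L]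
    lying over it.  The values come from algebraicity: two terms of a relation
    for [x] must be associated, so a power of [x] is a unit times an element of
    [E]; as values may be divided by integers, this determines that of [x]. *)
Theorem valuation_extends : exists u' : L -> ext G, valuation u' /\ extends_val j u u'.
Proof.
have [A [I [AI OA mI AImax]]] := proper_pair_maximal proper_pair_valuation.
apply: (@valuation_of_ring A).
- exact: (pp1 AI).
- exact: (ppD AI).
- exact: (ppN AI).
- exact: (ppM AI).
- exact: (maximal_valuation_ring AI AImax).
move=> a; split=> [Aa|ua]; last by apply: OA; exists a.
rewrite leNgt; apply/negP => /[dup] ua /neg_inv uVa.
have a0 : a != 0 by apply: contraTneq ua => ->; rewrite (rv0 uR).
apply: (ppI1 AI); rewrite -(mulfV (x := j a)) ?fmorph_eq0 //.
by apply: (ppIM AI) => //; apply: mI; exists a^-1; rewrite // fmorphV.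
Qed.
End Extension.

(** * Hasse derivatives and [epsilon] *)

Lemma nderivnM (R : comNzRingType) (p q : {poly R}) n :
  (p * q)^`N(n) = \sum_(i < n.+1) p^`N(i) * q^`N(n - i).
Proof.
elim/poly_ind: p n => [|p c IHp] n.
  by rewrite mul0r linear0 big1 // => i _; rewrite linear0 mul0r.
rewrite mulrDl mulrAC mul_polyC raddfD /= nderivnZ.
case: n => [|n]; first by rewrite big_ord1 !nderivn0 mulrDl mulrAC mul_polyC.
have := nderivnMXaddC n (p * q) 0; rewrite addr0 => ->.
rewrite !IHp [X in _ + X * _ + _]big_ord_recl [in RHS]big_ord_recl !nderivn0 !subn0 -mul_polyC.
under [X in _ = _ + X]eq_bigr => i _ do
  rewrite lift0 subSS nderivnMXaddC mulrDl mulrAC.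
under [X in _ + (_ + X) * _ + _]eq_bigr => i _ do rewrite lift0 subSS.
by rewrite big_split /= -mulr_suml; ring.
Qed.

Lemma deg_gt0 (K : fieldType) (f : {poly K}) : (0 < deg f)%N = (1 < size f)%N.
Proof. by rewrite /deg; case: (size f) => [|[]]. Qed.

Lemma deg_ltE (K : fieldType) (f F : {poly K}) : (0 < deg F)%N ->
  (deg f < deg F)%N = (size f < size F)%N.
Proof.
rewrite deg_gt0 /deg; case: (size F) => [|[|n]] // _.
by case: (size f).
Qed.

Section Epsilon.
Variables (G : divOagType) (K : fieldType) (w : {fraction {poly K}} -> ext G).
Hypothesis wV : valuation w.
Implicit Types (f g p q r F Q : {poly K}) (e : G).

Let wR : ring_valuation (pval w) := pval_ring wV.

Let epsilon_term_cmp f b e : f != 0 -> (0 < b)%N ->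
  ((epsilon_term w f b <= Fin e) = (pval w f <= ext_add (pval w f^`N(b)) (Fin (e *+ b)))) *
  ((epsilon_term w f b < Fin e) = (pval w f < ext_add (pval w f^`N(b)) (Fin (e *+ b)))).
Proof.
move=> f0 b0; rewrite /epsilon_term; have [x ->] := rv_fin wR f0.
have [->|/(rv_fin wR)[y ->]] := eqVneq (f^`N(b)) 0; first by rewrite (rv0 wR).
rewrite /= !ltNge !ext_leFin [y + _]addrC.
have {2 4}-> : x = b%:R^-1 *: (x - y) *+ b + y by rewrite oag_scaleVK // subrK.
by rewrite !oag_lerD2r !oag_lerMn2r.
Qed.

Lemma epsilon_le f e : f != 0 ->
  epsilon w f <= Fin e <->
  forall b, (0 < b)%N -> pval w f <= ext_add (pval w f^`N(b)) (Fin (e *+ b)).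
Proof.
move=> f0; have [[b /= b0 eb] ub] := epsilonP f wV; split=> [fe c c0|fe].
  by rewrite -epsilon_term_cmp //; apply: le_trans fe; apply: ub; exists c.
by rewrite -eb epsilon_term_cmp //; apply: fe.
Qed.

Lemma epsilon_lt f e : f != 0 ->
  epsilon w f < Fin e <->
  forall b, (0 < b)%N -> pval w f < ext_add (pval w f^`N(b)) (Fin (e *+ b)).
Proof.
move=> f0; have [[b /= b0 eb] ub] := epsilonP f wV.
split=> [fe c c0|fe].
  by rewrite -epsilon_term_cmp //; apply: le_lt_trans fe; apply: ub; exists c.
by rewrite -eb epsilon_term_cmp //; apply: fe.
Qed.

Lemma ABKP_epsilon_lt Q f : is_ABKP w Q -> (deg f < deg Q)%N -> epsilon w f < epsilon w Q.
Proof. by case=> _ _ QP; rewrite ltnNge ltNge; apply: contra => /QP. Qed.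

Lemma ABKP_epsilon_fin Q : is_ABKP w Q -> exists e, epsilon w Q = Fin e.
Proof.
move=> QP; have [_ Q0 _] := QP.
have := @ABKP_epsilon_lt Q 1 QP; rewrite /deg size_poly1 => /(_ Q0).
have [[b _ <-] _] := epsilonP Q wV; rewrite /epsilon_term.
case: (pval w Q) => [|x|]; rewrite ?ltNge //.
by case: (pval w _) => [|y|]; rewrite ?ltNge // => _; eexists.
Qed.

Lemma epsilon_attained f e : f != 0 -> epsilon w f = Fin e ->
  exists2 b, (0 < b)%N & pval w f = ext_add (pval w f^`N(b)) (Fin (e *+ b)).
Proof.
move=> f0 fe; have /(epsilon_le _ f0) le_fe : epsilon w f <= Fin e by rewrite fe.
apply: contrapT => noeq.
suff /(epsilon_lt _ f0) : forall b, (0 < b)%N ->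
    pval w f < ext_add (pval w f^`N(b)) (Fin (e *+ b)) by rewrite fe ltxx.
move=> b b0; rewrite lt_neqAle le_fe // andbT; apply/eqP => eq_b.
by apply: noeq; exists b.
Qed.

Section Products.
Variable e : G.

Let shifted f b : ext G := ext_add (pval w f^`N(b)) (Fin (e *+ b)).

Let shifted0 f : shifted f 0 = pval w f.
Proof. by rewrite /shifted nderivn0 mulr0n ext_add0. Qed.

Let shiftedM f g i k :
  ext_add (pval w (f^`N(i) * g^`N(k))) (Fin (e *+ (i + k))) =
  ext_add (shifted f i) (shifted g k).
Proof. by rewrite /shifted ext_addACA -(rvM wR) /= mulrnDr. Qed.

Let shifted_sum_lt b m n (P : pred 'I_n) (E : 'I_n -> {poly K}) : m < PInf ->
  (forall i, P i -> m < ext_add (pval w (E i)) (Fin (e *+ b))) ->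
  m < ext_add (pval w (\sum_(i < n | P i) E i)) (Fin (e *+ b)).
Proof.
have mK : m = ext_add (ext_add m (Fin (- (e *+ b)))) (Fin (e *+ b)).
  by rewrite -ext_addA /= addNr ext_add0.
rewrite {2 3}mK; move: (ext_add m _) mK => m' mK m_fin lt_m.
rewrite ext_ltD2r; apply: (rv_sum_lt wR) => [|i Pi].
  by case: m' mK m_fin lt_m => // -> .
by rewrite -(ext_ltD2r (e *+ b)); apply: lt_m.
Qed.

Lemma epsilon_mul_lt f g : f != 0 -> g != 0 ->
  epsilon w f < Fin e -> epsilon w g < Fin e -> epsilon w (f * g) < Fin e.
Proof.
move=> f0 g0 /(epsilon_lt _ f0) fe /(epsilon_lt _ g0) ge.
apply/epsilon_lt; first by rewrite mulf_neq0.
have [x fx] := rv_fin wR f0; have [y gy] := rv_fin wR g0.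
move=> b b0; rewrite nderivnM; apply: shifted_sum_lt.
  by apply: (rv_lt_pinf wR); rewrite mulf_neq0.
move=> i _; have -> : e *+ b = e *+ (i + (b - i)) by rewrite subnKC // -ltnS.
rewrite shiftedM (rvM wR) fx gy.
case: (nat_of_ord i) => [|k]; last first.
  apply: ext_ltleD; first by rewrite -fx; apply: fe.
  rewrite -gy; case: (b - _)%N => [|l]; first by rewrite shifted0.
  by apply/ltW/ge.
rewrite shifted0 fx subn0 ![ext_add (Fin x) _]ext_addC.
by apply: ext_ltleD => //; rewrite -gy; apply: ge.
Qed.

(** In Leibniz' rule for the derivative of order [b] of [q * F], the term
    deriving only [F] has strictly the least value. *)
Lemma epsilon_mul_attained q F b : q != 0 -> F != 0 ->
  epsilon w q < Fin e -> epsilon w F <= Fin e -> (0 < b)%N ->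
  pval w F = ext_add (pval w F^`N(b)) (Fin (e *+ b)) ->
  pval w (q * F) = ext_add (pval w (q * F)^`N(b)) (Fin (e *+ b)).
Proof.
move=> q0 F0 /(epsilon_lt _ q0) qe /(epsilon_le _ F0) Fe b0 Fb.
have [x qx] := rv_fin wR q0; have [y Fy] := rv_fin wR F0.
rewrite nderivnM big_ord_recl subn0 nderivn0.
set A := q * F^`N(b); have EA : pval w (q * F) = ext_add (pval w A) (Fin (e *+ b)).
  by rewrite /A !(rvM wR) Fb ext_addA.
rewrite (rvDl wR) // -(ext_ltD2r (e *+ b)) -EA.
apply: shifted_sum_lt; first by apply: (rv_lt_pinf wR); rewrite mulf_neq0.
move=> i _; rewrite lift0.
have -> : e *+ b = e *+ (i.+1 + (b - i.+1)) by rewrite subnKC.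
rewrite shiftedM (rvM wR) Fy.
apply: ext_ltleD; first exact: qe.
rewrite -Fy; case: (b - _)%N => [|l]; first by rewrite shifted0.
exact: Fe.
Qed.

End Products.

(** Write [f * g = q * F + r], and let [b] be an order at which [epsilon w F] is
    attained; it is also one for [q * F], while [epsilon] of [f * g] and of [r]
    is smaller.  If [q * F] had no larger value than [f * g], then its derivative
    of order [b] would have a smaller value than that of [f * g], hence the same
    value as that of [r], and [epsilon w r] would reach [epsilon w F]. *)
Lemma ABKP_mod F f g : is_ABKP w F -> (deg f < deg F)%N -> (deg g < deg F)%N ->
  pval w ((f * g) %% F) = pval w (f * g).
Proof.
move=> FP fF gF; have [Fmonic F_gt0 _] := FP; have F0 := monic_neq0 Fmonic.
have [->|f0] := eqVneq f 0; first by rewrite mul0r mod0p.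
have [->|g0] := eqVneq g 0; first by rewrite mulr0 mod0p.
have [e eF] := ABKP_epsilon_fin FP.
have small h : (deg h < deg F)%N -> epsilon w h < Fin e.
  by rewrite -eF; apply: ABKP_epsilon_lt.
have fg_small := epsilon_mul_lt f0 g0 (small f fF) (small g gF).
have fg0 : f * g != 0 by rewrite mulf_neq0.
set q := (f * g) %/ F; set r := _ %% F.
have fgE : f * g = q * F + r by rewrite -divp_eq.
have [q0|q0] := eqVneq q 0; first by rewrite fgE q0 mul0r add0r.
have qF : (deg q < deg F)%N.
  have sF : (1 < size F)%N by rewrite -deg_gt0.
  move: fF gF; rewrite !deg_ltE // => fF gF.
  rewrite size_divp // size_mul //.
  move: (size_poly_gt0 f) (size_poly_gt0 g) fF gF sF; rewrite f0 g0.
  by move: (size f) (size g) (size F) => a b c; clear; lia.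
have rF : (deg r < deg F)%N by rewrite deg_ltE // ltn_modp.
have [b b0 Fb] := epsilon_attained F0 eF.
have le_eF : epsilon w F <= Fin e by rewrite eF.
have qFb := epsilon_mul_attained q0 F0 (small q qF) le_eF b0 Fb.
have [lt_fg|le_qF] := ltP (pval w (f * g)) (pval w (q * F)).
  have -> : r = f * g + (- (q * F)) by rewrite fgE addrC addKr.
  by rewrite (rvDl wR) // (rvN wR).
have rE : r = f * g - q * F by rewrite fgE addrC addKr.
have fgb := proj1 (epsilon_lt _ fg0) fg_small _ b0.
have lt_b : pval w (q * F)^`N(b) < pval w (f * g)^`N(b).
  by rewrite -(ext_ltD2r (e *+ b)) -qFb; apply: le_lt_trans fgb.
have rb : pval w r^`N(b) = pval w (q * F)^`N(b).
  by rewrite rE nderivnB addrC (rvDl wR) (rvN wR).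
have le_r : pval w (q * F) <= pval w r by rewrite rE; apply: (rvB wR).
have r0 : r != 0.
  apply/eqP => r0; move: lt_b; rewrite -rb r0 linear0 (rv0 wR).
  by rewrite ltNge ext_lex.
have := proj1 (epsilon_lt _ r0) (small r rF) _ b0.
by rewrite rb -qFb ltNge le_r.
Qed.

(** The factors of a proper factorization have [epsilon] less than [epsilon w F],
    and then so has their product. *)
Lemma ABKP_irreducible F : is_ABKP w F -> irreducible_poly F.
Proof.
move=> FP; have [Fmonic F_gt0 _] := FP; have F0 := monic_neq0 Fmonic.
have sF : (1 < size F)%N by rewrite -deg_gt0.
have [e eF] := ABKP_epsilon_fin FP.
have small (h : {poly K}) : (size h < size F)%N -> epsilon w h < Fin e.
  by move=> hF; rewrite -eF; apply: ABKP_epsilon_lt => //; rewrite deg_ltE.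
split=> // f f1 fF; have f0 := dvdpN0 fF F0.
rewrite -dvdp_size_eqp // eqn_leq dvdp_leq //= leqNgt; apply/negP => lt_fF.
have FE : F = F %/ f * f by rewrite divpK.
have q0 : F %/ f != 0 by apply: contra F0 => /eqP q0; rewrite FE q0 mul0r.
have : epsilon w F < Fin e.
  rewrite FE; apply: epsilon_mul_lt => //; apply: small => //.
  rewrite size_divp // ltn_subrL; move: f1 (size_poly_gt0 f); rewrite f0 /deg.
  by case: (size f) => [|[|n]] //= _ _; rewrite ltnW.
by rewrite eF ltxx.
Qed.

End Epsilon.

(** * Key polynomials and evaluation at a root *)

Section ResidueField.
Variables (K L : fieldType) (iota : {rmorphism K -> L}) (F : {poly K}) (theta : L).
Hypothesis F_irr : monic_irreducible_poly F.

(** The proof that [theta] is a root is an argument so that the structure of ring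
    morphism can be inferred from the term. *)
Definition qfpoly_eval (_ : root (map_poly iota F) theta)
  (a : {poly %/ F with F_irr}) : L := (map_poly iota (a : {poly K})).[theta].

Hypothesis F_theta : root (map_poly iota F) theta.

Lemma horner_mod_root f : (map_poly iota (f %% F)).[theta] = (map_poly iota f).[theta].
Proof.
rewrite [in RHS](divp_eq f F) rmorphD rmorphM hornerD hornerM.
by rewrite (rootP F_theta) mulr0 add0r.
Qed.

Lemma qfpoly_modM (a b : {poly %/ F with F_irr}) :
  ((a * b : {poly %/ F with F_irr}) : {poly K}) = ((a : {poly K}) * b) %% F.
Proof.
have Fm : F \is monic by case: (F_irr).
rewrite Pdiv.IdomainMonic.modpE //.
by rewrite -[X in Pdiv.CommonRing.rmodp _ X](mk_monicE F_irr).
Qed.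

Fact qfpoly_eval_is_zmod_morphism : zmod_morphism (qfpoly_eval F_theta).
Proof. by move=> a b; rewrite /qfpoly_eval !raddfB /= hornerD hornerN. Qed.

Fact qfpoly_eval_is_monoid_morphism : monoid_morphism (qfpoly_eval F_theta).
Proof.
split; first by rewrite /qfpoly_eval rmorph1 hornerC.
by move=> a b; rewrite /qfpoly_eval qfpoly_modM horner_mod_root rmorphM hornerM.
Qed.

HB.instance Definition _ := GRing.isZmodMorphism.Build _ _ (qfpoly_eval F_theta)
  qfpoly_eval_is_zmod_morphism.
HB.instance Definition _ := GRing.isMonoidMorphism.Build _ _ (qfpoly_eval F_theta)
  qfpoly_eval_is_monoid_morphism.

End ResidueField.

Section Transport.
Variables (G : divOagType) (K : fieldType) (L : closedFieldType).
Variables (iota : {rmorphism K -> L}) (v : K -> ext G) (vbar : L -> ext G).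
Variable w : {fraction {poly K}} -> ext G.
Hypotheses (hL : is_alg_closure iota) (hK : henselian iota v).
Hypotheses (hvbar : valuation vbar) (hvbarv : extends_val iota v vbar).
Hypotheses (wV : valuation w) (wv : extends_val (@cst_frac K) v w).

Let wR : ring_valuation (pval w) := pval_ring wV.

(** By [ABKP_mod], [w] induces a valuation of K[X]/(F).  Extend it to [L] along
    the embedding that sends X to [theta]: the result extends [v], so it is
    [vbar] as K is henselian. *)
Theorem ABKP_root_val F theta f : is_ABKP w F -> root (map_poly iota F) theta ->
  (deg f < deg F)%N -> pval w f = vbar (map_poly iota f).[theta].
Proof.
move=> FP F_theta fF; have [Fmonic F_gt0 _] := FP; have F0 := monic_neq0 Fmonic.
have sF : (1 < size F)%N by rewrite -deg_gt0.
have FI : monic_irreducible_poly F by split=> //; apply: ABKP_irreducible FP.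
pose E := {poly %/ F with FI}.
have small (a : E) : (deg (a : {poly K}) < deg F)%N.
  by rewrite deg_ltE // -[in X in (_ < X)%N](mk_monicE FI) size_mk_monic.
pose u (a : E) := pval w (a : {poly K}).
have uV : valuation u.
  split=> [|a a0|a b|a b]; rewrite /u.
  - exact: (rv0 wR).
  - by apply: (rv_fin wR).
  - by rewrite qfpoly_modM ABKP_mod ?(rvM wR).
  - by case: wR.
pose j : {rmorphism E -> L} := @qfpoly_eval _ _ iota _ _ FI F_theta.
have j_alg x : algebraicOver j x.
  have [p p0 px] := hL x; exists (map_poly (qpolyC F) p).
    by rewrite map_poly_eq0.
  rewrite -map_poly_comp (eq_map_poly (g := iota)) // => c.
  by rewrite /= /qfpoly_eval /= map_polyC hornerC.
have [u' [u'V ju]] := valuation_extends uV j_alg.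
have <- : u' =1 vbar.
  apply: hK => // c; rewrite -wv -[RHS](ju (qpolyC F c)); congr u'.
  by rewrite /= /qfpoly_eval /= map_polyC hornerC.
have sf : (size f < size (mk_monic F))%N.
  by rewrite mk_monicE // -deg_ltE.
have fE : (in_qpoly F f : {poly K}) = f by apply: in_qpoly_small.
have := ju (in_qpoly F f); rewrite /u fE => <-.
by rewrite /= /qfpoly_eval fE.
Qed.

End Transport.

(** * Polynomials on balls *)

Section Balls.
Variables (G : divOagType) (L : closedFieldType) (v : L -> ext G).
Hypothesis vR : ring_valuation v.
Implicit Types (a c d x y z : L) (P : {poly L}) (s : seq L).

Lemma rv_prod_const s (E : L -> L) c : (forall b, b \in s -> v (E b) = v c) ->
  v (\prod_(b <- s) E b) = v (c ^+ size s).
Proof.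
elim: s => [|b s IHs] sE; first by rewrite big_nil.
rewrite big_cons /= exprS !(rvM vR) sE ?mem_head // IHs // => z zs.
by rewrite sE // inE zs orbT.
Qed.

Lemma rv_prod_min s (E : L -> L) d : d != 0 -> (forall b, b \in s -> v d <= v (E b)) ->
  v (\prod_(b <- s) E b) = v (d ^+ size s) -> forall b, b \in s -> v (E b) = v d.
Proof.
move=> d0; have [g vd] := rv_fin vR d0; elim: s => [|b s IHs] // sE.
have sE' z : z \in s -> v d <= v (E z) by move=> zs; rewrite sE // inE zs orbT.
have le_prod : v (d ^+ size s) <= v (\prod_(z <- s) E z).
  elim: s sE' {IHs sE} => [|z s IHs] sE; first by rewrite big_nil.
  rewrite big_cons exprS; apply: (rv_leM vR); first by rewrite sE ?mem_head.
  by apply: IHs => y ys; rewrite sE // inE ys orbT.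
rewrite big_cons /= exprS => e.
have Eb : v (E b) = v d.
  apply/le_anti; rewrite sE ?mem_head // andbT leNgt; apply/negP => lt_b.
  have := rv_ltleM vR lt_b le_prod (expf_neq0 _ d0).
  by rewrite e ltxx.
move=> z; rewrite inE => /orP[/eqP->//|]; apply: IHs => //.
move: e; rewrite !(rvM vR) Eb vd ![ext_add (Fin g) _]ext_addC => e.
by apply/le_anti; rewrite -(ext_leD2r g) e lexx -(ext_leD2r g) e lexx.
Qed.

(** The residue field is infinite, hence a closed ball has a point that is no
    closer than the radius to any of finitely many given ones.  Over an
    algebraically closed field, a root of the polynomial [P] below is such a
    point: it differs from each of the given points of the ball by an element of
    the value of [d], since the product of these differences is [- d ^+ n]. *)
Lemma exists_generic_point s a d : d != 0 ->
  exists2 x, v d <= v (x - a) & forall b, b \in s -> v (x - b) <= v d.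
Proof.
move=> d0; pose t := a :: [seq b <- s | v d <= v (b - a)].
have t_ball b : b \in t -> v d <= v (b - a).
  rewrite inE => /orP[/eqP->|]; first by rewrite subrr (rv0 vR) ext_lex.
  by rewrite mem_filter => /andP[].
pose P := \prod_(b <- t) ('X - b%:P) + (d ^+ size t)%:P.
have sP : size P != 1%N.
  rewrite size_polyDl size_prod_XsubC //= ltnS.
  by rewrite (leq_trans (size_polyC_leq1 _)).
have /closed_rootP[x] := sP; rewrite /root hornerD hornerC horner_prod addr_eq0 => /eqP xE.
have {}xE : v (\prod_(b <- t) (x - b)) = v (d ^+ size t).
  rewrite -(rvN vR (d ^+ _)) -xE; congr v.
  by apply: eq_bigr => b _; rewrite hornerXsubC.
have [g vd] := rv_fin vR d0.
have xa : v d <= v (x - a).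
  rewrite leNgt; apply/negP => lt_xa.
  have xa0 : x - a != 0 by apply: contraTneq lt_xa => ->; rewrite (rv0 vR) ltNge ext_lex.
  have [h vx] := rv_fin vR xa0.
  have : v (\prod_(b <- t) (x - b)) = v ((x - a) ^+ size t).
    apply: rv_prod_const => b /t_ball bt.
    have -> : x - b = (x - a) + (a - b) by rewrite addrA subrK.
    by rewrite (rvDl vR) // (rv_subC vR a) (lt_le_trans lt_xa).
  rewrite xE (rv_exp_fin vR _ vx) (rv_exp_fin vR _ vd) => -[] /oag_mulrn_inj gh.
  by move: lt_xa; rewrite vx vd gh ?ltxx.
exists x => // b bs; have [lt_b|le_b] := ltP (v (b - a)) (v d).
  have -> : x - b = - ((b - a) + (a - x)) by rewrite addrA subrK opprB.
  by rewrite (rvN vR) (rvDl vR) ?ltW // (rv_subC vR a) (lt_le_trans lt_b).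
suff -> : v (x - b) = v d by [].
apply: (rv_prod_min d0 _ xE) => [z /t_ball tz|].
  have -> : x - z = (x - a) - (z - a) by rewrite opprB addrA subrK.
  exact: (rvB vR).
by rewrite inE mem_filter le_b bs orbT.
Qed.

Corollary exists_generic_point_poly P a d : P != 0 -> d != 0 ->
  exists2 x, v d <= v (x - a) & forall b, root P b -> v (x - b) <= v d.
Proof.
move=> P0 d0; have [s PE] := closed_field_poly_normal P.
have [x xB x_gen] := exists_generic_point s a d0; exists x => // b.
rewrite {1}PE rootZ ?lead_coef_eq0 // root_prod_XsubC; exact: x_gen.
Qed.

(** Going from [x] to [y] cannot decrease the value of any factor [x - b]. *)
Lemma generic_point_min P (D : ext G) x y :
  (forall b, root P b -> v (x - b) <= D) -> D <= v (x - y) ->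
  v P.[x] <= v P.[y].
Proof.
move=> xP xy; have [->|P0] := eqVneq P 0; first by rewrite !horner0.
have [s PE] := closed_field_poly_normal P.
have sP b : b \in s -> root P b.
  by move=> bs; rewrite PE rootZ ?lead_coef_eq0 // root_prod_XsubC.
rewrite PE !hornerZ; apply: (rv_leM vR) => //.
elim: s {PE} sP => [|b s IHs] sP; first by rewrite !big_nil !hornerC.
rewrite !big_cons !hornerM !hornerXsubC; apply: (rv_leM vR); last first.
  by apply: IHs => z zs; rewrite sP // inE zs orbT.
have xb := xP b (sP b (mem_head _ _)).
have -> : y - b = (x - b) - (x - y) by rewrite opprB [RHS]addrC addrA subrK.
by apply: (rvB vR) => //; apply: le_trans xy.
Qed.

(** As in Cauchy's estimates, the value at a generic point [x] of the ball bounds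
    the Taylor coefficients at every point [y] of it: each of the factors
    [x - z] has at most the value [r] and at most the value of [y - z]. *)
Lemma cauchy_estimate P (r : G) x y b :
  (forall z, root P z -> v (x - z) <= Fin r) -> Fin r <= v (x - y) ->
  v P.[x] <= ext_add (v P^`N(b).[y]) (Fin (r *+ b)).
Proof.
move=> xP xy; have [->|P0] := eqVneq P 0; first by rewrite linear0 !horner0 (rv0 vR).
have [s PE] := closed_field_poly_normal P.
have sP z : z \in s -> v (x - z) <= Fin r.
  by move=> zs; apply: xP; rewrite PE rootZ ?lead_coef_eq0 // root_prod_XsubC.
rewrite PE nderivnZ !hornerZ !(rvM vR) -ext_addA; apply: ext_leD => //.
elim: s b {PE} sP => [|z s IHs] b sP.
  rewrite big_nil; case: b => [|b]; first by rewrite nderivn0 mulr0n ext_add0 !hornerC.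
  by rewrite -[1]/(1%:P) nderivnC horner0 (rv0 vR) ext_lex.
have xz := sP z (mem_head _ _).
have yz : v (x - z) <= v (y - z).
  have -> : y - z = (x - z) - (x - y) by rewrite opprB [RHS]addrC addrA subrK.
  by apply: (rvB vR) => //; apply: le_trans xy.
have {}IHs (i : nat) := IHs i (fun t ts => sP t (mem_behead (s := z :: s) ts)).
rewrite !big_cons hornerM hornerXsubC; set R := \prod_(_ <- s) _ in IHs *.
case: b => [|b].
  rewrite nderivn0 mulr0n ext_add0 hornerM hornerXsubC !(rvM vR); apply: ext_leD => //.
  by have := IHs 0; rewrite nderivn0 mulr0n ext_add0.
have -> : (('X - z%:P) * R)^`N(b.+1) = R^`N(b) + ('X - z%:P) * R^`N(b.+1).
  have := nderivnMXaddC b R 0; rewrite addr0 => RX.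
  by rewrite mulrBl nderivnB mulrC RX mul_polyC nderivnZ mulrBl mul_polyC addrA ['X * _]mulrC.
rewrite hornerD hornerM hornerXsubC (rvM vR).
apply: (rvD_shift vR); last by rewrite (rvM vR) -ext_addA; apply: ext_leD.
by rewrite ext_addC mulrSr -[Fin (_ + _)]/(ext_add (Fin (r *+ b)) (Fin r)) ext_addA; apply: ext_leD.
Qed.

(** A root [b] of [P] makes the Taylor expansion at [a] cancel, so some term
    of positive order weighs at most as much as the constant one. *)
Lemma root_distance P a b (r : G) : root P b -> v (a - b) = Fin r ->
  ~ (forall i, (0 < i)%N -> v P.[a] < ext_add (v P^`N(i).[a]) (Fin (r *+ i))).
Proof.
move=> /rootP Pb ab lt_P.
have Pa_fin : v P.[a] < PInf.
  by apply: lt_le_trans (lt_P 1%N isT) _; apply: ext_lex.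
have := nderiv_taylor_wide (mulrC a (b - a)) (leqnSn (size P)).
rewrite addrC subrK Pb big_ord_recl expr0 mulr1 nderivn0 => sum0.
have lt_sum : v P.[a] < v (\sum_(i < size P) P^`N(lift ord0 i).[a] * (b - a) ^+ lift ord0 i).
  apply: (rv_sum_lt vR) => // i _.
  rewrite (rvM vR) (rv_exp_fin vR (g := r)) ?lift0; first exact: lt_P.
  by rewrite (rv_subC vR).
have := rvDl vR lt_sum; rewrite -sum0 (rv0 vR) => Pa.
by move: Pa_fin; rewrite -Pa ltxx.
Qed.

End Balls.

(** * Degrees of algebraic elements *)

Section Degrees.
Variables (K : fieldType) (L : closedFieldType) (iota : {rmorphism K -> L}).
Implicit Types (f g : {poly K}) (x : L).

Local Notation "f ^i" := (map_poly iota f) (at level 2, format "f ^i").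

Lemma has_dim_le (E : set L) m n : has_dim iota E m -> has_dim iota E n -> (m <= n)%N.
Proof.
move=> [e [eE e_dec]] [e' [eE' e_dec']].
have coords k l (a : 'I_k -> L) (b : 'I_l -> L) : (forall i, E (a i)) ->
    (forall x, E x -> exists! c : 'rV[K]_l, x = \sum_i iota (c 0 i) * b i) ->
    exists A : 'M[K]_(k, l), forall i, a i = \sum_j iota (A i j) * b j.
  move=> aE dec; have /choice[r rP] i : exists c : 'rV[K]_l,
      a i = \sum_j iota (c 0 j) * b j.
    by have [c [cE _]] := dec _ (aE i); exists c.
  by exists (\matrix_(i, j) r i 0 j) => i; rewrite rP; apply: eq_bigr => j _; rewrite mxE.
have [A eA] := coords _ _ e e' eE e_dec'.
have [B eB] := coords _ _ e' e eE' e_dec.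
apply: (@mulmx1_min _ _ _ A B).
apply/row_matrixP => i; have [c [_ c_uniq]] := e_dec _ (eE i).
rewrite -(c_uniq (row i (A *m B))); last first.
  rewrite {1}eA (eq_bigr (fun j => \sum_k iota (A i j) * iota (B j k) * e k)).
    rewrite exchange_big; apply: eq_bigr => k _; rewrite !mxE rmorph_sum mulr_suml.
    by apply: eq_bigr => j _; rewrite rmorphM.
  by move=> j _; rewrite eB mulr_sumr; apply: eq_bigr => k _; rewrite mulrA.
apply: c_uniq; rewrite (bigD1 i) //= !mxE eqxx rmorph1 mul1r big1 ?addr0 // => k ki.
by rewrite !mxE eq_sym (negbTE ki) rmorph0 mul0r.
Qed.

Lemma irreducible_root_dvd f g x : irreducible_poly g -> root g^i x -> root f^i x -> g %| f.
Proof.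
move=> g_irr gx fx; have := irreducible_poly_coprime f g_irr.
case: (g %| f) => //= gf; have : coprimep g^i f^i by rewrite coprimep_map.
by move/coprimep_root => /(_ x gx); rewrite (rootP fx) eqxx.
Qed.

Lemma horner_rV n (c : 'rV[K]_n) x :
  (rVpoly c)^i.[x] = \sum_i iota (c 0 i) * x ^+ i.
Proof.
rewrite (@horner_coef_wide _ n) ?size_map_poly ?size_poly //.
by apply: eq_bigr => i _; rewrite coef_map coef_rVpoly_ord.
Qed.

Lemma adegree_root g x : g \is monic -> irreducible_poly g -> root g^i x ->
  adegree iota x = deg g.
Proof.
move=> gm g_irr gx; have g0 := monic_neq0 gm.
have sg : size g = (deg g).+1 by rewrite /deg prednK // size_poly_gt0.
have gx_dim : has_dim iota (adjoin iota x) (deg g).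
  exists (fun i : 'I_(deg g) => x ^+ i); split=> [i|y [p [q [qx ->]]]].
    by exists 'X^i, 1; rewrite map_polyXn hornerXn rmorph1 hornerC divr1 oner_eq0.
  have : coprimep g q.
    rewrite irreducible_poly_coprime //; apply: contra qx => /dvdpP[r ->].
    by rewrite rmorphM hornerM (rootP gx) mulr0.
  move/Bezout_eq1_coprimepP => [[a b] /= ab1].
  have bE : (q^i.[x])^-1 = b^i.[x].
    apply: (mulfI qx); rewrite mulfV //.
    have := congr1 (fun r => r^i.[x]) ab1; rewrite rmorphD !rmorphM hornerD !hornerM.
    by rewrite (rootP gx) mulr0 add0r rmorph1 hornerC mulrC.
  set r := (p * b) %% g; have rE : p^i.[x] / q^i.[x] = r^i.[x].
    by rewrite bE -hornerM -rmorphM /r horner_mod_root.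
  have sr : (size r <= deg g)%N by rewrite -ltnS -sg ltn_modp.
  exists (poly_rV r); split; first by rewrite -horner_rV poly_rV_K.
  move=> c; rewrite rE -horner_rV => e.
  have : root (r - rVpoly c)^i x by rewrite /root rmorphB hornerD hornerN -e subrr.
  move/(irreducible_root_dvd g_irr gx) => /dvdp_leq le_g.
  have {le_g} : r - rVpoly c == 0.
    apply: contraT => /le_g; rewrite leqNgt sg ltnS (leq_trans (size_polyD _ _)) //.
    by rewrite geq_max sr size_polyN size_poly.
  by rewrite subr_eq0 => /eqP->; rewrite rVpolyK.
apply: xget_unique => // n xn; apply/eqP.
by rewrite eqn_leq (has_dim_le xn gx_dim) (has_dim_le gx_dim xn).
Qed.

Lemma exists_minpoly : is_alg_closure iota -> forall x,
  exists g, [/\ g \is monic, irreducible_poly g & root g^i x].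
Proof.
move=> hL x; have [p p0 px] := hL x.
pose P n := `[< exists f, [/\ f != 0, root f^i x & size f = n] >].
have exP : exists n, P n by exists (size p); apply/asboolP; exists p.
case: (ex_minnP exP) => n /asboolP[f [f0 fx sf]] n_min.
pose g := (lead_coef f)^-1 *: f; have l0 : (lead_coef f)^-1 != 0.
  by rewrite invr_eq0 lead_coef_eq0.
have g0 : g != 0 by rewrite scaler_eq0 negb_or l0.
have gx : root g^i x by rewrite map_polyZ rootZ ?fmorph_eq0.
have sg : size g = n by rewrite size_scale.
have g_min q : q != 0 -> root q^i x -> (size g <= size q)%N.
  by move=> q0 qx; rewrite sg; apply: n_min; apply/asboolP; exists q.
exists g; split=> //.
  by rewrite monicE lead_coefZ mulVf // lead_coef_eq0.
split.
  rewrite ltnNge; apply/negP => /size1_polyC gC; move: gx g0; rewrite gC.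
  by rewrite map_polyC /root hornerC fmorph_eq0 polyC_eq0 => ->.
move=> q q1 qg; have q0 := dvdpN0 qg g0.
rewrite -dvdp_size_eqp // eqn_leq dvdp_leq //=.
have gE : g = g %/ q * q by rewrite divpK.
have d0 : g %/ q != 0 by apply: contra g0 => /eqP d0; rewrite gE d0 mul0r.
move: gx; rewrite gE rmorphM rootM => /orP[dx|]; last by rewrite -gE; apply: g_min.
have := g_min _ d0 dx; rewrite size_divp // leqNgt ltn_subrL; move: q1 (size_poly_gt0 q).
rewrite q0; case: (size q) => [|[|k]] //= _ _.
by rewrite size_poly_gt0 g0.
Qed.

Lemma adegree_le_root f x : is_alg_closure iota -> f != 0 -> root f^i x ->
  (adegree iota x <= deg f)%N.
Proof.
move=> hL f0 fx; have [g [gm g_irr gx]] := exists_minpoly hL x.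
rewrite (adegree_root gm g_irr gx) /deg -!subn1 leq_sub2r // dvdp_leq //.
exact: irreducible_root_dvd gx fx.
Qed.

End Degrees.

(** * Truncations and closeness to a root of [F] *)

Lemma seq_max (d : Order.disp_t) (T : orderType d) (A : eqType) (E : A -> T) (s : seq A) :
  s != [::] -> exists2 x, x \in s & forall y, y \in s -> (E y <= E x)%O.
Proof.
elim: s => // x s IHs _; have [->|/IHs[y ys y_max]] := eqVneq s [::].
  by exists x; rewrite ?mem_head // => y; rewrite inE => /eqP->.
have [le_yx|/ltW le_xy] := leP (E y) (E x).
  exists x; rewrite ?mem_head // => z; rewrite inE => /orP[/eqP->//|/y_max].
  by move=> /le_trans; apply.
exists y; first by rewrite inE ys orbT.
by move=> z; rewrite inE => /orP[/eqP->//|/y_max].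
Qed.

Section Distances.
Variables (G : divOagType) (K : fieldType) (L : closedFieldType).
Variables (iota : {rmorphism K -> L}) (vbar : L -> ext G).
Variables (w : {fraction {poly K}} -> ext G) (F : {poly K}) (theta : L).
Hypotheses (hvbar : valuation vbar) (wV : valuation w) (F_gt0 : (0 < deg F)%N).
Hypothesis F_val : forall f, (deg f < deg F)%N ->
  pval w f = vbar (map_poly iota f).[theta].
Implicit Types (f g Q : {poly K}) (x y b : L) (r : G).

Local Notation "f ^i" := (map_poly iota f) (at level 2, format "f ^i").

Let wR : ring_valuation (pval w) := pval_ring wV.
Let vR : ring_valuation vbar. Proof. exact/valuation_ring. Qed.

Lemma deg_nderivn f i : (0 < i)%N -> (deg f^`N(i) <= (deg f).-1)%N.
Proof.
move=> i0; rewrite /deg -!subn1 leq_sub2r //; apply/leq_sizeP => k.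
rewrite coef_nderivn => le_k; rewrite nth_default ?mul0rn //.
by move: le_k; rewrite leq_subLR => /leq_trans; apply; rewrite leq_add2r.
Qed.

Lemma map_poly_horner_neq0 g : g != 0 -> (deg g < deg F)%N -> g^i.[theta] != 0.
Proof.
move=> g0 gF; have [x gx] := rv_fin wR g0; apply/eqP => g_theta.
by move: gx; rewrite F_val // g_theta (rv0 vR).
Qed.

Lemma nderivn_val f i : (0 < i)%N -> (deg f <= deg F)%N ->
  pval w f^`N(i) = vbar (f^i)^`N(i).[theta].
Proof.
move=> i0 fF; rewrite nderivn_map F_val // (leq_ltn_trans (deg_nderivn _ i0)) //.
by case: (deg f) fF => // n; apply: leq_trans.
Qed.

(** For [g] nonconstant, [epsilon w g] is the extreme slope of the Newton polygon
    of the Taylor expansion of [g] at [theta], and this slope is the largest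
    value of [theta - b] for a root [b] of [g].  Here is one inequality, and in
    the next lemma the other. *)
Lemma root_dist_le_epsilon g b : g != 0 -> (deg g < deg F)%N -> root g^i b ->
  vbar (theta - b) <= epsilon w g.
Proof.
move=> g0 gF gb; have g_theta := map_poly_horner_neq0 g0 gF.
have theta_b : theta - b != 0.
  by rewrite subr_eq0; apply: contraNneq g_theta => ->; apply/eqP/rootP.
have [r br] := rv_fin vR theta_b; rewrite br leNgt; apply/negP.
move/(epsilon_lt wV _ g0) => lt_g; apply: (root_distance vR gb br) => i i0.
by rewrite -F_val // -nderivn_val // 1?ltnW //; apply: lt_g.
Qed.

Lemma epsilon_le_root_dist g r : g != 0 -> (deg g < deg F)%N ->
  (forall b, root g^i b -> vbar (theta - b) <= Fin r) -> epsilon w g <= Fin r.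
Proof.
move=> g0 gF roots_g; apply/(epsilon_le wV _ g0) => i i0.
rewrite F_val // nderivn_val // 1?ltnW //; apply: (cauchy_estimate vR) => //.
by rewrite subrr (rv0 vR) ext_lex.
Qed.

Section Truncation.
Variables (Q : {poly K}) (alpha : L) (r : G).
Hypotheses (Q_monic : Q \is monic) (Q_gt0 : (0 < deg Q)%N) (QF : (deg Q < deg F)%N).
Hypotheses (Q_alpha : root Q^i alpha) (alpha_dist : vbar (theta - alpha) = Fin r).
Hypothesis Q_dist : forall b, root Q^i b -> vbar (theta - b) <= Fin r.
Hypothesis low_dist : forall g b, g != 0 -> (deg g < deg Q)%N -> root g^i b ->
  vbar (theta - b) < Fin r.

Let ball x := Fin r <= vbar (theta - x).

Let Q0 : Q != 0 := monic_neq0 Q_monic.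

Let low_const g x : (deg g < deg Q)%N -> ball x -> vbar g^i.[x] = vbar g^i.[theta].
Proof.
have [->|g0] := eqVneq g 0; first by rewrite rmorph0 !horner0.
move=> gQ xB; apply/le_anti/andP; split; apply: (generic_point_min vR (D := Fin r)) => //.
- move=> b gb; have lt_b := low_dist g0 gQ gb.
  have -> : x - b = (theta - b) + - (theta - x) by rewrite opprB [RHS]addrC addrA subrK.
  by rewrite (rvDl vR) ?ltW // (rvN vR) (lt_le_trans lt_b).
- by rewrite (rv_subC vR).
- by move=> b gb; apply/ltW/(low_dist g0 gQ gb).
Qed.

Let Q_min x : ball x -> vbar Q^i.[theta] <= vbar Q^i.[x].
Proof. by move=> xB; apply: (generic_point_min vR (D := Fin r)). Qed.

Let deg_qcoef f i : (deg (qcoef Q f i) < deg Q)%N.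
Proof.
by rewrite deg_ltE // size_qcoef.
Qed.

(** Peel off the lowest coefficient: [f] and [f %% Q] agree at [alpha], and the
    value of the latter is constant on the ball; so [m] also bounds
    [f %/ Q * Q * k].  At a point generic for [f %/ Q] and [Q] the values of both
    are minimal, so [Q] may be replaced with its value at [theta]. *)
Let qexpansion_ge f i k (m : ext G) :
  (forall x, ball x -> m <= vbar (f^i.[x] * k)) ->
  m <= vbar ((qcoef Q f i)^i.[theta] * Q^i.[theta] ^+ i * k).
Proof.
elim: i f k => [|i IHi] f k f_ge.
  rewrite /qcoef !expr0 divp1 mulr1.
  have alphaB : ball alpha by rewrite /ball alpha_dist.
  have low : (deg (f %% Q) < deg Q)%N by have := deg_qcoef f 0; rewrite /qcoef expr0 divp1.
  rewrite (rvM vR) -(low_const low alphaB) -(rvM vR) (horner_mod_root Q_alpha).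
  exact: f_ge.
have -> : qcoef Q f i.+1 = qcoef Q (f %/ Q) i by rewrite /qcoef exprS divp_divl.
rewrite exprSr mulrA -mulrA; apply: IHi => x xB.
have low : (deg (f %% Q) < deg Q)%N by have := deg_qcoef f 0; rewrite /qcoef expr0 divp1.
have alphaB : ball alpha by rewrite /ball alpha_dist.
have fQ_ge y : ball y -> m <= vbar (((f %/ Q)^i.[y] * Q^i.[y]) * k).
  move=> yB; rewrite -hornerM -rmorphM.
  have -> : f %/ Q * Q = f - f %% Q by rewrite [X in X - _](divp_eq f Q) addrK.
  rewrite rmorphB hornerD hornerN mulrBl; apply: (rvB vR); first exact: f_ge.
  rewrite (rvM vR) (low_const low yB) -(low_const low alphaB) -(rvM vR).
  by rewrite (horner_mod_root Q_alpha); apply: f_ge.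
have [-> |fQ0] := eqVneq (f %/ Q) 0; first by rewrite rmorph0 horner0 mul0r (rv0 vR) ext_lex.
have d0 : theta - alpha != 0.
  by apply/eqP => d0; move: alpha_dist; rewrite d0 (rv0 vR).
have P0 : (f %/ Q * Q)^i != 0 by rewrite map_poly_eq0 mulf_neq0.
have [z zB z_root] := exists_generic_point_poly vR theta P0 d0.
rewrite alpha_dist in zB z_root.
have zB' : ball z by rewrite /ball (rv_subC vR).
have zx y : ball y -> Fin r <= vbar (z - y).
  move=> yB; have -> : z - y = (z - theta) + (theta - y) by rewrite addrA subrK.
  exact: (rvD vR).
apply: le_trans (fQ_ge z zB') _; rewrite mulrA; apply: (rv_leM vR) => //.
apply: (rv_leM vR); apply: (generic_point_min vR (D := Fin r)) => //.
- by move=> b b_root; apply: z_root; rewrite rmorphM rootM b_root.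
- exact: zx.
- by move=> b b_root; apply: z_root; rewrite rmorphM rootM b_root orbT.
Qed.

Let term_val f i : pval w (qcoef Q f i * Q ^+ i) =
  vbar ((qcoef Q f i)^i.[theta] * Q^i.[theta] ^+ i).
Proof.
rewrite (rvM wR) (rvM vR) F_val; last by rewrite (ltn_trans (deg_qcoef _ _)).
have [x Qx] := rv_fin wR Q0; have Qx' := Qx; rewrite F_val // in Qx'.
by rewrite (rv_exp_fin wR _ Qx) (rv_exp_fin vR _ Qx').
Qed.

(** If no root of [f] is closer to [theta] than [r], the value of [f] is minimal
    at [theta] among the points of the ball, so [qexpansion_ge] applies. *)
Lemma trunc_ge f : (deg f < deg F)%N ->
  (forall b, root f^i b -> vbar (theta - b) <= Fin r) ->
  pval w f <= trunc w Q f.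
Proof.
move=> fF f_dist; apply/bigmin_geP; split; first exact: ext_lex.
move=> i _; rewrite term_val -[_ * _ ^+ _]mulr1; apply: qexpansion_ge => x xB.
by rewrite mulr1 F_val //; apply: (generic_point_min vR (D := Fin r)).
Qed.

(** The terms of the [Q]-expansion have no smaller values on the ball than at
    [theta], so [pval w f] bounds [f] on the ball; take Cauchy's estimates. *)
Lemma epsilon_le_trunc f : f != 0 -> (deg f <= deg F)%N ->
  pval w f <= trunc w Q f -> epsilon w f <= Fin r.
Proof.
move=> f0 fF /bigmin_geP[_ f_ge].
have f_ball x : ball x -> pval w f <= vbar f^i.[x].
  move=> xB; rewrite (qexpansionE f Q_monic Q_gt0) rmorph_sum horner_sum.
  rewrite -(qexpansionE f Q_monic Q_gt0).
  apply: (rv_sum vR) => i _; apply: le_trans (f_ge i isT) _.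
  rewrite term_val rmorphM rmorphXn hornerM horner_exp.
  rewrite (rvM vR) [leRHS](rvM vR); apply: ext_leD; first by rewrite low_const.
  elim: (nat_of_ord i) => [|n IHn] //; rewrite !exprS; apply: (rv_leM vR) => //.
  exact: Q_min.
have d0 : theta - alpha != 0.
  by apply/eqP => d0; move: alpha_dist; rewrite d0 (rv0 vR).
have fi0 : f^i != 0 by rewrite map_poly_eq0.
have [z zB z_root] := exists_generic_point_poly vR theta fi0 d0.
rewrite alpha_dist in zB z_root.
apply/(epsilon_le wV _ f0) => i i0; rewrite (nderivn_val i0 fF).
apply: (@le_trans _ _ (vbar f^i.[z])); first by apply: f_ball; rewrite /ball (rv_subC vR).
exact: (cauchy_estimate vR).
Qed.

End Truncation.
End Distances.

(** * Distinguished pairs *)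

Theorem theorem1p13 (G : divOagType) (K : fieldType) (L : closedFieldType)
    (iota : {rmorphism K -> L}) (v : K -> ext G) (vbar : L -> ext G)
    (w : {fraction {poly K}} -> ext G) (Q F : {poly K})
    (hL : is_alg_closure iota)
    (hv : valuation v) (hK : henselian iota v)
    (hvbar : valuation vbar) (hvbarv : extends_val iota v vbar)
    (hw : valuation w) (hwv : extends_val (@cst_frac K) v w)
    (hQ : is_ABKP w Q) (hQw : trunc_neq w Q)
    (hF : is_ABKP w F) :
  distinguished_poly_pair iota vbar F Q <->
  (psi w Q F /\ (deg Q < deg F)%N).
Proof.
have [Qm Q_gt0 QP] := hQ; have [Fm F_gt0 FP] := hF.
have Q0 := monic_neq0 Qm; have F0 := monic_neq0 Fm.
have Q_irr := ABKP_irreducible hw hQ; have F_irr := ABKP_irreducible hw hF.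
have vR : ring_valuation vbar by apply/valuation_ring.
have degQ x : root (map_poly iota Q) x -> adegree iota x = deg Q.
  exact: adegree_root.
have degF x : root (map_poly iota F) x -> adegree iota x = deg F.
  exact: adegree_root.
have deg_root (g : {poly K}) x : g != 0 -> root (map_poly iota g) x -> (adegree iota x <= deg g)%N.
  exact: adegree_le_root.
have F_val theta f : root (map_poly iota F) theta -> (deg f < deg F)%N ->
    pval w f = vbar (map_poly iota f).[theta].
  by move=> F_theta; apply: (ABKP_root_val hL hK hvbar hvbarv hw hwv hF F_theta).
split.
- move=> [_ _ [theta [alpha [F_theta Q_alpha []]]]].
  rewrite degQ // degF // => QF [_ theta_max] theta_low.
  have {}F_val := F_val theta ^~ F_theta.
  have dist b : (adegree iota b < deg F)%N -> vbar (theta - b) <= vbar (theta - alpha).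
    by move=> bF; apply: theta_max; exists b.
  have [r alpha_dist] : exists r, vbar (theta - alpha) = Fin r.
    apply: (rv_fin vR); rewrite subr_eq0; apply/eqP => ta.
    by move: QF; rewrite -(degQ _ Q_alpha) -ta degF // ltnn.
  rewrite alpha_dist in dist theta_low.
  have Q_dist b : root (map_poly iota Q) b -> vbar (theta - b) <= Fin r.
    by move=> Qb; apply: dist; rewrite degQ.
  have low_dist (g : {poly K}) b : g != 0 -> (deg g < deg Q)%N -> root (map_poly iota g) b ->
      vbar (theta - b) < Fin r.
    by move=> g0 gQ gb; apply: theta_low; apply: leq_ltn_trans gQ; apply: deg_root gb.
  have eps_Q : epsilon w Q = Fin r.
    apply/le_anti; rewrite (epsilon_le_root_dist hvbar hw F_gt0 F_val) //=.
    by rewrite -alpha_dist (root_dist_le_epsilon hvbar hw F_gt0 F_val).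
  (* otherwise [epsilon w F] would not exceed [epsilon w Q], and [hF] would give
     [deg F <= deg Q] *)
  have F_trunc : trunc w Q F < pval w F.
    rewrite ltNge; apply/negP => F_trunc.
    have := epsilon_le_trunc hvbar hw F_gt0 F_val Qm Q_gt0 QF alpha_dist Q_dist low_dist
      F0 (leqnn _) F_trunc.
    by rewrite -eps_Q => /FP; rewrite leqNgt QF.
  split=> //; split=> //; split; first by exists F.
  move=> _ [f /= f_trunc <-]; rewrite leEnat leqNgt; apply/negP => fF.
  move: f_trunc; rewrite ltNge; have [->|f0] := eqVneq f 0.
    by rewrite /trunc size_poly0 big_ord0 ext_lex.
  rewrite (trunc_ge hvbar hw F_val Qm Q_gt0 QF Q_alpha alpha_dist) // => b fb.
  by apply: dist; apply: leq_ltn_trans fF; apply: deg_root fb.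
move=> [[_ _ [_ F_min]] QF].
have F_trunc f : (deg f < deg F)%N -> pval w f <= trunc w Q f.
  move=> fF; rewrite leNgt; apply/negP => f_trunc.
  have /F_min : alpha_set w Q (deg f) by exists f.
  by rewrite leEnat leqNgt fF.
have exists_root (f : {poly K}) : (0 < deg f)%N -> exists x, root (map_poly iota f) x.
  by rewrite deg_gt0 => f_gt1; apply/closed_rootP; rewrite size_map_poly gtn_eqF.
have [theta F_theta] := exists_root F F_gt0.
have {}F_val := F_val theta ^~ F_theta.
have [alpha Q_alpha alpha_max] : exists2 alpha, root (map_poly iota Q) alpha &
    forall b, root (map_poly iota Q) b -> vbar (theta - b) <= vbar (theta - alpha).
  have [s sE] := closed_field_poly_normal (map_poly iota Q).
  have sP b : root (map_poly iota Q) b = (b \in s).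
    by rewrite sE rootZ ?lead_coef_eq0 ?map_poly_eq0 // root_prod_XsubC.
  have [x Qx] := exists_root Q Q_gt0.
  have [|a sa a_max] := @seq_max _ _ _ (fun b => vbar (theta - b)) s.
    by apply/eqP => s0; move: Qx; rewrite sP s0.
  by exists a => [|b]; rewrite sP //; apply: a_max.
have [r alpha_dist] : exists r, vbar (theta - alpha) = Fin r.
  apply: (rv_fin vR); rewrite subr_eq0; apply/eqP => ta.
  by move: QF; rewrite -(degQ _ Q_alpha) -ta degF // ltnn.
rewrite alpha_dist in alpha_max.
have eps_Q : epsilon w Q = Fin r.
  apply/le_anti; rewrite (epsilon_le_root_dist hvbar hw F_gt0 F_val) //=.
  by rewrite -alpha_dist (root_dist_le_epsilon hvbar hw F_gt0 F_val).
have low_dist (g : {poly K}) b : g != 0 -> (deg g < deg Q)%N -> root (map_poly iota g) b ->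
    vbar (theta - b) < Fin r.
  move=> g0 gQ gb; rewrite -eps_Q.
  apply: le_lt_trans (ABKP_epsilon_lt hQ gQ).
  by apply: (root_dist_le_epsilon hvbar hw F_gt0 F_val) => //; apply: ltn_trans QF.
split=> //; exists theta, alpha; split=> //; split; rewrite ?(degF _ F_theta) ?(degQ _ Q_alpha) //.
  split; first by exists alpha; rewrite //= degQ.
  move=> _ [b /= bF <-]; have [g [gm g_irr gb]] := exists_minpoly hL b.
  rewrite (adegree_root gm g_irr gb) in bF; have g0 := monic_neq0 gm.
  rewrite alpha_dist; apply: (@le_trans _ _ (epsilon w g)).
    exact: (root_dist_le_epsilon hvbar hw F_gt0 F_val).
  apply: (epsilon_le_trunc hvbar hw F_gt0 F_val Qm Q_gt0 QF alpha_dist alpha_max low_dist) => //.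
    exact: ltnW.
  exact: F_trunc.
move=> eta etaQ; have [g [gm g_irr g_eta]] := exists_minpoly hL eta.
rewrite (adegree_root gm g_irr g_eta) in etaQ.
by rewrite alpha_dist; apply: low_dist g_eta => //; apply: monic_neq0.
Qed.
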